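(* Let $\psi\colon \mathbb{N}\to[0,\tfrac12)$ be a function such that $q\mapsto q\psi(q)$ is non-increasing and tends to zero as $q\to\infty$, and suppose that the limit $\lambda:=\lim_{q\to\infty}\frac{-\log\psi(q)}{\log q}$ exists. Then $$\dim_{\mathrm H}\mathrm{Exact}(2,\psi)=\frac{3}{\lambda+1}.$$
   Context: $\mathbb{N}$ denotes the set of positive integers, and $\dim_{\mathrm H}$ denotes Hausdorff dimension. For $x\in\mathbb{R}$, $\|x\|:=\min\{|x-m|\colon m\in\mathbb{Z}\}$ is the distance from $x$ to the nearest integer. For a positive integer $n$ and a function $\psi\colon\mathbb{N}\to[0,\infty)$, the $\psi$-simultaneously-well approximable set is $$W(n,\psi):=\Big\{(x_1,\ldots,x_n)\in[0,1]^n\colon \max_{1\le i\le n}\|qx_i\|<\psi(q)\text{ for infinitely many } q\in\mathbb{N}\Big\},$$ and the exact $\psi$-simultaneously-well approximable set is $$\mathrm{Exact}(n,\psi):=W(n,\psi)\setminus\bigcup_{0<c<1}W(n,c\psi).$$ Conventions: $-\log 0=+\infty$; the limit $\lambda$ is allowed to be $+\infty$, in which case $3/(\lambda+1)$ is read as $0$; the Hausdorff dimension of the empty set is $0$. *)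

(* Defs.v *)
From HB Require Import structures.
From mathcomp Require Import all_boot all_order all_algebra.
From mathcomp Require Import all_classical all_reals all_analysis.

Set Implicit Arguments.
Unset Strict Implicit.
Unset Printing Implicit Defensive.

Import Order.TTheory GRing.Theory Num.Theory.
Import numFieldNormedType.Exports.

Local Open Scope classical_set_scope.
Local Open Scope ring_scope.

Section Hausdorff.
Context {R : realType} {V : normedModType R}.
Implicit Types (A B : set V) (U : nat -> set V) (s d : R).
Local Open Scope ereal_scope.

(* Distances are taken in the norm of V. On 'rV[R]_n this is the maximum norm;
   Hausdorff dimension is the same for the equivalent Euclidean norm.

   The element 0 only matters for the empty set, whose diameter is 0. *)
Definition diam B : \bar R :=
  ereal_sup (0 |` [set `|p.1 - p.2|%:E | p in B `*` B]).

(* diam(B)^s, with diam(set0)^0 = 0 and diam([set x])^0 = 1, so that the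
   0-dimensional Hausdorff measure is the counting measure. *)
Definition diam_pow s B : \bar R :=
  if B == set0 then 0 else diam B `^ s.

(* Countable covers are indexed by nat; finite ones are padded by set0. *)
Definition hausdorff_content s d A : \bar R :=
  ereal_inf [set \sum_(0 <= i <oo) diam_pow s (U i) | U in
    [set U : nat -> set V |
      A `<=` \bigcup_i U i /\ forall i, diam (U i) <= d%:E]].

(* The limit as d tends to 0+ is a supremum, by monotonicity in d. *)
Definition hausdorff_measure s A : \bar R :=
  ereal_sup [set hausdorff_content s d A | d in [set d | (0 < d)%R]].

Definition hausdorff_dim A : \bar R :=
  ereal_inf [set s%:E | s in [set s | (0 <= s)%R /\ hausdorff_measure s A = 0]].

End Hausdorff.

Section Approximation.
Context {R : realType}.
Implicit Types (x : R) (n : nat) (psi : nat -> R).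

(* The infimum is a minimum, see dist_int_attained. *)
Definition dist_int x : R := inf [set `|x - m%:~R| | m in [set: int]].

Lemma dist_int_attained x : exists m : int, dist_int x = `|x - m%:~R|.
Proof.
have [m mP] : exists m : int, forall k : int, `|x - m%:~R| <= `|x - k%:~R|.
  have f1 := floor_le x; have f2 := floorD1_gt x.
  set a := Num.floor x in f1 f2; rewrite intrD mulr1z in f2.
  exists (if x - a%:~R <= a%:~R + 1 - x then a else (a + 1)%R) => k.
  have kP : k%:~R <= a%:~R :> R \/ a%:~R + 1 <= k%:~R :> R.
    have [ka|ak] := leP k a; first by left; rewrite ler_int.
    by right; rewrite -[X in _ + X]mulr1z -intrD ler_int -ltzD1 ltrD2r.
  case: ifPn => [|/negP/negP]; rewrite -?ltNge => h; rewrite ?intrD ?mulr1z.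
    rewrite (ger0_norm (x := x - a%:~R)) ?subr_ge0//.
    case: kP => kP; first by rewrite (le_trans _ (ler_norm _))// lerB.
    by rewrite (le_trans h)// distrC (le_trans _ (ler_norm _))// lerB.
  rewrite (distrC x (a%:~R + 1)) (ger0_norm (x := _ + 1 - x)); last first.
    by rewrite subr_ge0 ltW.
  case: kP => kP.
    by rewrite (le_trans (ltW h))// (le_trans _ (ler_norm _))// lerB.
  by rewrite distrC (le_trans _ (ler_norm _))// lerB.
exists m; apply/le_anti/andP; split.
  by apply: ge_inf; [exists 0 => _ [k _ <-]|exists m].
by apply: lb_le_inf; [exists `|x - m%:~R|; exists m|move=> _ [k _ <-]].
Qed.

(* A point of R^n is a row vector; the positive integers are the q : nat with
   0 < q, and psi 0 is never used. *)
Definition well_approximable n psi : set 'rV[R]_n :=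
  [set x | (forall i, 0 <= x 0 i <= 1) /\
    infinite_set [set q : nat | (0 < q)%N /\
      \big[Num.max/0]_(i < n) dist_int (q%:R * x 0 i) < psi q]].

Arguments well_approximable : clear implicits.

Definition exact_approximable n psi : set 'rV[R]_n :=
  well_approximable n psi `\`
  \bigcup_(c in [set c : R | 0 < c < 1])
    well_approximable n (fun q => c * psi q).

End Approximation.

Arguments well_approximable {R} n psi _.
Arguments exact_approximable {R} n psi _.

(* Main.v *)
Require Import Defs.
From mathcomp Require Import all_boot all_order all_algebra.
From mathcomp Require Import all_classical all_reals all_analysis.
From mathcomp Require Import zify ring lra.
Import Order.TTheory GRing.Theory Num.Theory.
Import numFieldNormedType.Exports.
Local Open Scope classical_set_scope.
Local Open Scope ring_scope.

Set Implicit Arguments.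
Unset Strict Implicit.
Unset Printing Implicit Defensive.

                                                                                 
                                                                           

                                                                            
                                                                               
                                                                              
                                                                                
                                                                               
                                                                                
                                                                                
                                                                               
                                                                              
                                                                                 
                                                                             
                                                                           
                                                               

                                                                          

                 

(** Upper bound. The exact set lies in [well_approximable 2 psi]. A denominator q contributes at
    most (q+1)^2 squares of diameter at most 2 psi(q)/q. If psi(q) <= q^(-tau) for large q, the s-th
    powers of these diameters have a convergent sum as soon as s (tau+1) > 3, so the measure
    vanishes ([hausdorff_measure_well_approximable]). Every tau below lambda qualifies.

    Lower bound. A Cantor set is built inside the exact set. Its nodes are rational points p/q in
    lowest terms. With r = psi(q)/q and eta_k = 1/(k+2), the box of a node at level k is a small
    square on which the first coordinate exceeds p1/q by between (1 - eta_k) r and (1 - eta_k/2) r.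
    A point of the box is psi-approximated by p/q, but neither p/q nor an integer multiple of the
    vector (q,p) approximates it within c psi when c <= 1 - eta_k. As eta_k tends to 0, a branch
    point is exact provided that no other rational with denominator between those of a node and of
    its child comes within psi ([branch_exact]).

    Children with this property come from [exists_children]. A grid of mesh h = 4C/m^3 is laid in
    the parent box, and Dirichlet's theorem with denominators up to m^2 is applied at each grid
    point. Two kinds of grid points are discarded. Those whose rational has denominator at most
    m^2/C are a proportion of order 1/C ([card_small_denominator]). Those near a foreign rational of
    denominator Q <= X = 2 q psi(q) m^2 are few because q psi(q) is small compared with eta_k
    ([card_other_rational]). For X < Q < q' a foreign rational is repelled by the child p'/q', since
    two distinct rationals cannot be that close. A fixed proportion of the grid survives.

    The dimension is read off by a mass distribution argument in counting form ([cantor_content]). A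
    node has of the order of m^6 children, and if psi(q) >= q^(-theta) their boxes have side at
    least of the order of m^(-2(theta+1)). So the s-dimensional content is positive when s (theta+1)
    < 3, for any theta above lambda, and theta and tau may be taken as close to lambda as needed. *)

(** * Elementary counting: integer points in boxes, grouped sums *)

Lemma filter_nil (T : eqType) (L : seq T) (p : pred T) :
  {in L, forall t, ~~ p t} -> [seq t <- L | p t] = [::].
Proof.
move=> H; rewrite (eq_in_filter (a2 := pred0)) ?filter_pred0// => t.
by move=> /H/negPf.
Qed.

Section Counting.
Context {R : realType}.

(** An interval of length 2t contains at most 2t + 1 integers. All later counts of rationals and of
    grid points are reduced to this one by a pair of injective integer coordinates. *)
Lemma size_int_box (T : eqType) (s : seq T) (f g : T -> int)
    (c1 c2 t1 t2 : R) :
  uniq s -> {in s &, injective (fun x => (f x, g x))} ->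
  0 <= t1 -> 0 <= t2 ->
  (forall x, x \in s -> `|(f x)%:~R - c1| <= t1 /\ `|(g x)%:~R - c2| <= t2) ->
  (size s)%:R <= (2 * t1 + 1) * (2 * t2 + 1).
Proof.
move=> us fgI t10 t20 H.
pose rng (c t : R) :=
  [seq Num.ceil (c - t) + k%:Z | k <- iota 0 (Num.truncn (2 * t)).+1].
have in_rng c t z : 0 <= t -> `|z%:~R - c| <= t -> z \in rng c t.
  move=> t0; rewrite ler_norml => /andP[z1 z2].
  have lo : Num.ceil (c - t) <= z by rewrite ceil_le_int; lra.
  apply/mapP; exists `|z - Num.ceil (c - t)|%N; last first.
    by rewrite gez0_abs ?subr_ge0//; ring.
  rewrite mem_iota add0n ltnS /=.
  rewrite truncn_ge_nat; last lra.
  rewrite natr_absz ger0_norm ?subr_ge0// rmorphB /=.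
  have := ceil_ge (c - t); lra.
have szrng c t : 0 <= t -> (size (rng c t))%:R <= 2 * t + 1.
  move=> t0; rewrite size_map size_iota -natr1 lerD2r truncn_le; lra.
have /uniq_leq_size : uniq [seq (f x, g x) | x <- s] by rewrite map_inj_in_uniq.
move=> /(_ [seq (x, y) | x <- rng c1 t1, y <- rng c2 t2]).
rewrite size_map size_allpairs => le_s.
rewrite (@le_trans _ _ (size (rng c1 t1) * size (rng c2 t2))%:R)//.
  rewrite ler_nat; apply: le_s => _ /mapP[x xs ->].
  by have [h1 h2] := H x xs; apply/allpairs_f; exact: in_rng.
by rewrite natrM ler_pM// szrng.
Qed.

Lemma sum_by_key (T : eqType) (L : seq T) (key : T -> nat) (J : nat)
    (c b : nat -> R) (F : T -> R) :
  (forall t, t \in L -> (key t < J)%N /\ F t <= c (key t)) ->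
  (forall j, (j < J)%N -> 0 <= c j) ->
  (forall j, (j < J)%N -> (size [seq t <- L | key t == j])%:R <= b j) ->
  \sum_(t <- L) F t <= \sum_(j < J) b j * c j.
Proof.
move=> Hk c0 Hb.
have -> : \sum_(t <- L) F t = \sum_(j < J) \sum_(t <- L | key t == j) F t.
  rewrite (exchange_big_dep xpredT)//= big_seq [RHS]big_seq.
  apply: eq_bigr => t tL; have [kJ _] := Hk t tL.
  by rewrite (big_pred1 (Ordinal kJ)).
apply: ler_sum => j _.
apply: (@le_trans _ _ (\sum_(t <- L | key t == j) c j)).
  rewrite big_seq_cond [leRHS]big_seq_cond; apply: ler_sum => t /andP[tL /eqP tj].
  by have [_] := Hk t tL; rewrite tj.
rewrite -big_filter big_const_seq count_predT iter_addr_0 -mulr_natl.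
by rewrite ler_wpM2r// ?c0 ?Hb.
Qed.

(** Telescoping: 1/(u+1)^2 <= 1/u - 1/(u+1), whence the sharper bound proved by induction. *)
Lemma sum_inv_sq (n : nat) : \sum_(1 <= j < n) (j%:R ^- 2 : R) <= 2.
Proof.
suff H k : \sum_(1 <= j < k.+2) (j%:R ^- 2 : R) <= 2 - k.+1%:R^-1.
  case: n => [|[|n]]; [by rewrite big_geq| by rewrite big_geq|].
  by apply: (le_trans (H n)); rewrite gerBl invr_ge0.
elim: k => [|k IH]; first by rewrite big_nat1 expr1n invr1; lra.
rewrite big_nat_recr//=; apply: (le_trans (lerD IH (lexx _))).
have k0 : 0 < k.+1%:R :> R by rewrite ltr0n.
rewrite -(natr1 k.+1); set u : R := k.+1%:R in k0 *.
have -> : 2 - u^-1 + (u + 1) ^- 2 = 2 - (u + 1)^-1 - u^-1 * (u + 1) ^- 2.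
  by field; lra.
by rewrite gerBl mulr_ge0// ?invr_ge0 ?exprn_ge0; lra.
Qed.

End Counting.

(** * Grid points close to rational points *)

Section Grid.
Context {R : realType}.
Variables (a1 a2 h : R) (M n : nat) (rho : nat -> R).
Hypotheses (h0 : 0 < h) (rho0 : forall Q, 0 <= rho Q).

Definition grid_pt (a : R) (i : nat) : R := a + h * (i%:R + 2^-1).

Definition hits (Q : nat) (P : int * int) (g : 'I_M * 'I_M) : Prop :=
  `|grid_pt a1 g.1 - P.1%:~R / Q%:R| <= rho Q /\
  `|grid_pt a2 g.2 - P.2%:~R / Q%:R| <= rho Q.

Lemma card_hits (Q : nat) (P : int * int) :
  #|[pred g | `[<hits Q P g>]]|%:R <= (2 * rho Q / h + 1) ^+ 2 :> R.
Proof.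
rewrite cardE expr2.
have -> : 2 * rho Q / h = 2 * (rho Q / h) by rewrite mulrA.
apply: (@size_int_box R _ (enum [pred g | `[<hits Q P g>]])
  (fun g => (g.1 : nat)%:Z) (fun g => (g.2 : nat)%:Z)
  ((P.1%:~R / Q%:R - a1) / h - 2^-1) ((P.2%:~R / Q%:R - a2) / h - 2^-1)).
- exact: enum_uniq.
- by move=> [i j] [i' j'] _ _ /= [/ord_inj -> /ord_inj ->].
- by rewrite divr_ge0 ?rho0 ?ltW.
- by rewrite divr_ge0 ?rho0 ?ltW.
move=> [i j]; rewrite mem_enum => /asboolP [].
rewrite /grid_pt /= => H1 H2.
have aux a (k : nat) (y : R) : `|a + h * (k%:R + 2^-1) - y| <= rho Q ->
    `|k%:Z%:~R - ((y - a) / h - 2^-1)| <= rho Q / h.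
  move=> H; rewrite ler_pdivlMr// -[X in _ * X](gtr0_norm h0) -normrM.
  apply: le_trans H; rewrite le_eqVlt; apply/orP; left; apply/eqP; congr `|_|.
  rewrite -pmulrn; field. by rewrite gt_eqF.
split; [exact: aux H1|exact: aux H2].
Qed.

(** A union bound over rationals P/Q. The numerators range over an infinite set, so one P is chosen
    for each pair of a denominator and a grid point that is hit; the finitely many chosen rationals
    still hit every grid point concerned. *)
Lemma hits_union_bound (E : nat -> int * int -> Prop) :
  exists L : seq (nat * (int * int)), [/\ uniq L,
    forall t, t \in L ->
      [/\ (t.1 < n)%N, E t.1 t.2 & exists g, hits t.1 t.2 g] &
    #|[pred g | `[<exists Q P, [/\ (Q < n)%N, E Q P & hits Q P g]>]]|%:R
      <= \sum_(t <- L) (2 * rho t.1 / h + 1) ^+ 2 :> R].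
Proof.
pose B Q g := exists P, E Q P /\ hits Q P g.
pose ch Q g : int * int := xget (0, 0) [set P | E Q P /\ hits Q P g].
have chP Q g : B Q g -> E Q (ch Q g) /\ hits Q (ch Q g) g.
  by move=> [P HP]; have := @xgetPex _ (0, 0) [set P | E Q P /\ hits Q P g]
    (ex_intro _ P HP).
pose S := [seq x <- [seq (Q, g) | Q <- iota 0 n, g <- enum {: 'I_M * 'I_M}]
  | `[<B x.1 x.2>]].
exists (undup [seq (x.1, ch x.1 x.2) | x <- S]).
have SP Q g : B Q g -> (Q < n)%N -> (Q, g) \in S.
  move=> b Qn; rewrite mem_filter /=; apply/andP; split; first exact/asboolP.
  by apply/allpairsP; exists (Q, g); split; rewrite ?mem_iota ?mem_enum.
split; first exact: undup_uniq.
  move=> t; rewrite mem_undup => /mapP[[Q g]].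
  rewrite mem_filter /= => /andP[/asboolP b].
  move=> /allpairsP[[Q' g'] /= [Qn _ [eQ eg]]] ->; subst Q' g'.
  have [e hh] := chP _ _ b; rewrite mem_iota in Qn.
  by split => //; exists g.
apply: (@le_trans _ _ (\sum_(t <- undup [seq (x.1, ch x.1 x.2) | x <- S])
    #|[pred g | `[<hits t.1 t.2 g>]]|%:R)); last first.
  by apply: ler_sum => t _; exact: card_hits.
rewrite -natr_sum ler_nat.
under eq_bigr => t _ do rewrite -sum1_card big_mkcond /=.
rewrite -sum1_card big_mkcond /= exchange_big /=; apply: leq_sum => g _.
rewrite inE; case: asboolP => // -[Q [P [Qn e hQ]]].
have b : B Q g by exists P.
have tL : (Q, ch Q g) \in undup [seq (x.1, ch x.1 x.2) | x <- S].
  by rewrite mem_undup; apply/mapP; exists (Q, g) => //; exact: SP.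
rewrite (big_rem _ tL) /= inE; case: asboolP => // nh.
by have [] := chP _ _ b.
Qed.

End Grid.

(** * Simultaneous Dirichlet approximation in lowest terms *)

Section Dirichlet.
Context {R : realType}.

(** For q > 0: the rational point p/q has no representation with a denominator smaller than q, that
    is, gcd(p1, p2, q) = 1. *)
Definition primitive (p1 p2 : int) (q : nat) : Prop :=
  forall (t : nat) (P1 P2 : int), (0 < t < q)%N ->
    q%:Z * P1 = t%:Z * p1 -> q%:Z * P2 = t%:Z * p2 -> False.

Lemma dirichlet (x1 x2 : R) (m : nat) : (0 < m)%N ->
  exists (q : nat) (P1 P2 : int), [/\ (0 < q <= m ^ 2)%N,
    `|q%:R * x1 - P1%:~R| < m%:R^-1 & `|q%:R * x2 - P2%:~R| < m%:R^-1].
Proof.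
case: m => // m _.
pose fr (y : R) := y - (Num.floor y)%:~R.
have fr0 y : 0 <= fr y by rewrite subr_ge0 floor_le.
have fr1 y : fr y < 1 by have := floorD1_gt y; rewrite /fr intrD; lra.
pose c y : 'I_m.+1 := inord (Num.truncn (m.+1%:R * fr y)).
have cE y : (c y : nat) = Num.truncn (m.+1%:R * fr y).
  rewrite inordK// truncn_lt_nat ?mulr_ge0//.
  by rewrite -[ltRHS]mulr1 ltr_pM2l// ltr0n.
have c_close y z : c y = c z -> `|fr y - fr z| < m.+1%:R^-1.
  move=> /(congr1 val); rewrite /= !cE => e.
  have m0 : 0 < m.+1%:R :> R by rewrite ltr0n.
  have /andP[y1 y2] := truncn_itv (mulr_ge0 (ltW m0) (fr0 y)).
  have /andP[z1 z2] := truncn_itv (mulr_ge0 (ltW m0) (fr0 z)).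
  rewrite -(ltr_pM2l m0) mulfV ?gt_eqF// -[X in X * _](gtr0_norm m0) -normrM.
  rewrite mulrBr ltr_norml; move: y1 y2 z1 z2; rewrite e -natr1; lra.
(* Pigeonhole: one more multiple than there are cells of side 1/m in the unit square (m is now
   written [m.+1]). *)
pose f (j : 'I_(m.+1 ^ 2).+1) := (c (j%:R * x1), c (j%:R * x2)).
have /injectivePn[j [k jk]] : ~~ injectiveb f.
  apply/negP => /injectiveP /leq_card.
  by rewrite card_prod !card_ord mulnn ltnn.
wlog kj : j k jk / (k < j)%N.
  move=> H; move: (jk); rewrite neq_ltn => /orP[lt|lt] e.
    by apply: (H k j) => //; rewrite eq_sym.
  exact: (H j k).
move=> [/c_close e1 /c_close e2].
exists (j - k)%N, (Num.floor (j%:R * x1) - Num.floor (k%:R * x1)),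
  (Num.floor (j%:R * x2) - Num.floor (k%:R * x2)).
split; first by rewrite subn_gt0 kj /= (leq_trans (leq_subr _ _))// -ltnS.
- apply: le_lt_trans e1; rewrite le_eqVlt; apply/orP; left; apply/eqP.
  by congr `|_|; rewrite /fr natrB 1?ltnW// rmorphB /=; ring.
- apply: le_lt_trans e2; rewrite le_eqVlt; apply/orP; left; apply/eqP.
  by congr `|_|; rewrite /fr natrB 1?ltnW// rmorphB /=; ring.
Qed.

(** The least q admitting the two inequalities is in lowest terms: if p/q had a smaller denominator
    t, the errors for t would be those for q multiplied by t/q < 1, against minimality. *)
Lemma dirichlet_primitive (x1 x2 : R) (m : nat) : (0 < m)%N ->
  exists (q : nat) (P1 P2 : int), [/\ (0 < q <= m ^ 2)%N, primitive P1 P2 q,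
    `|q%:R * x1 - P1%:~R| < m%:R^-1 & `|q%:R * x2 - P2%:~R| < m%:R^-1].
Proof.
move=> m0.
have [q0 [a [b [/andP[q00 q0m] ha hb]]]] := dirichlet x1 x2 m0.
pose A q := `[<exists P1 P2 : int, [/\ (0 < q)%N,
  `|q%:R * x1 - P1%:~R| < m%:R^-1 & `|q%:R * x2 - P2%:~R| < m%:R^-1]>].
have exA : exists q, A q by exists q0; apply/asboolP; exists a, b.
case: (ex_minnP exA) => q /asboolP[P1 [P2 [qpos h1 h2]]] qmin.
exists q, P1, P2; split => //.
  rewrite qpos (leq_trans _ q0m)//; apply: qmin.
  by apply/asboolP; exists a, b.
move=> t T1 T2 /andP[t0 tq] e1 e2.
suff /qmin : A t by rewrite leqNgt tq.
have aux (x : R) (T P : int) : q%:Z * T = t%:Z * P ->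
    `|q%:R * x - P%:~R| < m%:R^-1 -> `|t%:R * x - T%:~R| < m%:R^-1.
  move=> e h; have q0' : 0 < q%:R :> R by rewrite ltr0n.
  have t0' : 0 < t%:R :> R by rewrite ltr0n.
  have tq' : t%:R < q%:R :> R by rewrite ltr_nat.
  have := congr1 (fun z : int => z%:~R : R) e; rewrite !rmorphM /= => e'.
  have -> : t%:R * x - T%:~R = t%:R / q%:R * (q%:R * x - P%:~R).
    have -> : T%:~R = t%:R * P%:~R / q%:R :> R.
      by rewrite [t%:R]pmulrn -e' -pmulrn; field; rewrite gt_eqF.
    by field; rewrite gt_eqF.
  rewrite normrM ger0_norm ?divr_ge0 ?ltW//; apply: le_lt_trans h.
  by rewrite ler_piMl// ler_pdivrMr// mul1r ltW.
by apply/asboolP; exists T1, T2; split => //; [exact: aux e1 h1|exact: aux e2 h2].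
Qed.

End Dirichlet.

                             

(** * Counting the bad grid points *)

Section Fibers.
Context {R : realType}.
Variables (a1 a2 h : R) (M : nat) (rho : nat -> R).
Hypotheses (h0 : 0 < h) (rho0 : forall Q, 0 <= rho Q).

Lemma grid_pt_center (a : R) (i : 'I_M) :
  `|grid_pt h a i - (a + M%:R * h / 2)| <= M%:R * h / 2.
Proof.
have -> : grid_pt h a i - (a + M%:R * h / 2) =
    h * (i%:R + 2^-1 - M%:R / 2) by rewrite /grid_pt; ring.
rewrite normrM gtr0_norm// (_ : M%:R * h / 2 = h * (M%:R / 2)); last by ring.
rewrite ler_pM2l// ler_norml.
have : i.+1%:R <= M%:R :> R by rewrite ler_nat.
rewrite -natr1; have : 0 <= i%:R :> R by []; lra.
Qed.

(** For a fixed denominator Q each numerator lies in an interval of length Q times the side of the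
    grid enlarged by rho on both sides. *)
Lemma size_hits_fiber (L : seq (nat * (int * int))) (Q : nat) :
  uniq L -> (0 < Q)%N ->
  (forall t, t \in L -> exists g : 'I_M * 'I_M, hits a1 a2 h rho t.1 t.2 g) ->
  (size [seq t <- L | t.1 == Q])%:R
    <= (Q%:R * (M%:R * h) + 2 * (Q%:R * rho Q) + 1) ^+ 2.
Proof.
move=> uL Q0 HL; have Q0' : 0 < Q%:R :> R by rewrite ltr0n.
pose t := Q%:R * (M%:R * h / 2 + rho Q).
have -> : Q%:R * (M%:R * h) + 2 * (Q%:R * rho Q) + 1 = 2 * t + 1.
  by rewrite /t; field.
have t0 : 0 <= t.
  by rewrite mulr_ge0// addr_ge0// ?rho0// divr_ge0// mulr_ge0// ltW.
have aux a (i : 'I_M) (z : int) : `|grid_pt h a i - z%:~R / Q%:R| <= rho Q ->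
    `|z%:~R - Q%:R * (a + M%:R * h / 2)| <= t.
  move=> H; rewrite [X in `|X|](_ : _ =
    Q%:R * (z%:~R / Q%:R - (a + M%:R * h / 2))); last by field; rewrite gt_eqF.
  rewrite normrM gtr0_norm// ler_pM2l//.
  rewrite distrC in H; apply: le_trans (ler_distD (grid_pt h a i) _ _) _.
  by rewrite addrC lerD// grid_pt_center.
rewrite expr2; apply: (@size_int_box R _ _ (fun t => t.2.1) (fun t => t.2.2)
  (Q%:R * (a1 + M%:R * h / 2)) (Q%:R * (a2 + M%:R * h / 2))) => //.
- exact: filter_uniq.
- move=> [Q1 [x1 y1]] [Q2 [x2 y2]]; rewrite !mem_filter /=.
  by move=> /andP[/eqP-> _] /andP[/eqP-> _] [-> ->].
move=> [Q1 [x1 y1]]; rewrite mem_filter /= => /andP[/eqP-> /HL[g [/= H1 H2]]].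
by split; [exact: aux H1|exact: aux H2].
Qed.

End Fibers.

Section DirichletBad.
Context {R : realType}.

                                          
                                                                          
(** Put u = m^2/C. There are at most (Q l + 3)^2 relevant rationals of denominator Q, and each is
    within 1/(Qm) of at most (u/(2Q) + 1)^2 grid points. Summed over Q <= u, the main term is of
    order l^2 u^3, which is a proportion of order 1/C of the (l/h)^2 grid points. *)
Lemma card_small_denominator (a1 a2 h l : R) (C m M : nat) :
  (0 < C)%N -> (0 < m)%N -> h = 4 * C%:R / m%:R ^+ 3 -> M%:R * h <= l ->
  #|[pred g : 'I_M * 'I_M | `[<exists Q P,
      [/\ (Q < (m ^ 2 %/ C).+1)%N, (0 < Q)%N &
        hits a1 a2 h (fun Q => (Q%:R * m%:R)^-1) Q P g]>]]|%:R
   <= 9 / 2 * (l ^+ 2 * m%:R ^+ 6 / C%:R ^+ 3) + 81 * (m%:R ^+ 4 / C%:R ^+ 2)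
   :> R.
Proof.
move=> C0 m0 hE Ml.
have C0' : 0 < C%:R :> R by rewrite ltr0n.
have m0' : 0 < m%:R :> R by rewrite ltr0n.
have h0 : 0 < h by rewrite hE divr_gt0 ?mulr_gt0 ?exprn_gt0.
have l0 : 0 <= l by apply: le_trans Ml; rewrite mulr_ge0// ltW.
set n := (m ^ 2 %/ C).+1; set rho := fun Q : nat => _.
have rho0 Q : 0 <= rho Q by rewrite invr_ge0 mulr_ge0.
have [L [uL HL]] := @hits_union_bound R a1 a2 h M n rho h0 rho0
  (fun Q _ => (0 < Q)%N).
move=> /le_trans; apply.
pose b (Q : nat) : R := if Q == 0%N then 0 else
  (Q%:R * (M%:R * h) + 2 * (Q%:R * rho Q) + 1) ^+ 2.
pose c (Q : nat) : R := (2 * rho Q / h + 1) ^+ 2.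
have := @sum_by_key R _ L (fun t => t.1) n c b (fun t => c t.1).
move=> /(_ _ _ _)/le_trans; apply.
- by move=> t /HL[tn _ _]; split.
- by move=> j _; rewrite sqr_ge0.
- move=> j jn; rewrite /b; case: (eqVneq j 0%N) => [->|j0].
    by rewrite filter_nil// => t /HL[_]; rewrite -lt0n.
  apply: (@size_hits_fiber R a1 a2) => //; first by rewrite lt0n.
  by move=> t /HL[_ _ [g hg]]; exists g.
rewrite -(big_mkord xpredT (fun j => b j * c j)) big_ltn// {1}/b eqxx mul0r add0r.
pose u : R := m%:R ^+ 2 / C%:R.
have u0 : 0 < u by rewrite divr_gt0 ?exprn_gt0.
have nu : n.-1%:R <= u.
  by rewrite ler_pdivlMr// -natrM -natrX ler_nat leq_trunc_div.
(* Since 1 <= j <= u, the product of the two factors before squaring is at most (3/2) l u + (9/2)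
   u/j; the square is then split by (a+b)^2 <= 2a^2 + 2b^2. *)
have term j : (1 <= j < n)%N ->
    b j * c j <= 9 / 2 * (l * u) ^+ 2 + 81 / 2 * u ^+ 2 * j%:R ^- 2.
  move=> /andP[j0 jn]; rewrite /b gtn_eqF//.
  have j0' : 0 < j%:R :> R by rewrite ltr0n.
  have ju : j%:R <= u by apply: le_trans nu; rewrite ler_nat.
  have j1 : 1 <= j%:R :> R by rewrite ler1n.
  have m1 : 1 <= m%:R :> R by rewrite ler1n.
  have im : m%:R^-1 <= 1 :> R by rewrite invf_le1.
  have -> : 2 * (j%:R * rho j) = 2 * m%:R^-1.
    by rewrite /rho; field; rewrite !gt_eqF.
  have cE : 2 * rho j / h + 1 = u / (2 * j%:R) + 1.
    by rewrite /rho hE /u; field; rewrite !gt_eqF.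
  rewrite /c cE -exprMn.
  have : (j%:R * (M%:R * h) + 2 * m%:R^-1 + 1) * (u / (2 * j%:R) + 1) <=
      3 / 2 * (l * u) + 9 / 2 * (u / j%:R).
    apply: (@le_trans _ _ ((j%:R * l + 3) * (u / (2 * j%:R) + 1))).
      apply: ler_wpM2r.
        by rewrite addr_ge0// divr_ge0 ?mulr_ge0// ltW.
      have : j%:R * (M%:R * h) <= j%:R * l by rewrite ler_wpM2l.
      lra.
    have -> : (j%:R * l + 3) * (u / (2 * j%:R) + 1) =
      l * u / 2 + j%:R * l + 3 / 2 * (u / j%:R) + 3.
      by field; rewrite gt_eqF.
    have : j%:R * l <= l * u by rewrite mulrC ler_wpM2l.
    have : 1 <= u / j%:R by rewrite ler_pdivlMr// mul1r.
    lra.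
  set y := (X in X <= _); set v := u / j%:R.
  have y0 : 0 <= y.
    rewrite /y mulr_ge0//; last by rewrite addr_ge0// divr_ge0 ?mulr_ge0// ltW.
    by rewrite !addr_ge0 ?mulr_ge0 ?invr_ge0// ?mulr_ge0// ltW.
  have -> : 81 / 2 * u ^+ 2 / j%:R ^+ 2 = 81 / 2 * v ^+ 2.
    by rewrite /v; field; rewrite gt_eqF.
  move=> yle; apply: (@le_trans _ _ ((3 / 2 * (l * u) + 9 / 2 * v) ^+ 2)).
    by rewrite ler_sqr ?nnegrE// (le_trans y0).
  have := sqr_ge0 (3 / 2 * (l * u) - 9 / 2 * v).
  rewrite !sqrrD !sqrrN; nra.
apply: (@le_trans _ _ (\sum_(1 <= j < n)
   (9 / 2 * (l * u) ^+ 2 + 81 / 2 * u ^+ 2 * j%:R ^- 2))).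
  by rewrite !big_nat; apply: ler_sum => j; exact: term.
rewrite big_split /= -[X in _ + X <= _]mulr_sumr lerD//.
  rewrite sumr_const_nat -[leLHS]mulr_natr.
  apply: (@le_trans _ _ (9 / 2 * (l * u) ^+ 2 * u)).
    by rewrite ler_wpM2l ?mulr_ge0 ?sqr_ge0// subn1.
  rewrite le_eqVlt; apply/orP; left; apply/eqP; rewrite /u.
  by field; rewrite gt_eqF.
apply: (@le_trans _ _ (81 / 2 * u ^+ 2 * 2)).
  by rewrite ler_wpM2l ?mulr_ge0 ?sqr_ge0// sum_inv_sq.
rewrite le_eqVlt; apply/orP; left; apply/eqP; rewrite /u.
by field; rewrite gt_eqF.
Qed.

End DirichletBad.

Section OtherRationals.
Context {R : realType}.
Variable psi : nat -> R.
Hypothesis psi_ge0 : forall q, (0 < q)%N -> 0 <= psi q.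
Hypothesis psi_noninc : forall p q : nat, (0 < p)%N -> (p <= q)%N ->
  q%:R * psi q <= p%:R * psi p.

(** Proportionality of the vectors (Q,P) and (q,p); for positive denominators it says that P/Q and
    p/q are the same point. *)
Definition collinear (p1 p2 : int) (q : nat) (P : int * int) (Q : nat) : Prop :=
  q%:Z * P.1 = Q%:Z * p1 /\ q%:Z * P.2 = Q%:Z * p2.

Lemma psi_le_inv (q Q : nat) : (0 < q)%N -> (q <= Q)%N ->
  psi Q <= q%:R * psi q / Q%:R.
Proof.
move=> q0 qQ; rewrite ler_pdivlMr ?ltr0n ?(leq_trans q0)// mulrC.
exact: psi_noninc.
Qed.

Lemma psi_quot_le (q Q : nat) : (0 < q)%N -> (q <= Q)%N ->
  psi Q / Q%:R <= psi q / q%:R.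
Proof.
move=> q0 qQ; have Q0 := leq_trans q0 qQ.
have q0' : 0 < q%:R :> R by rewrite ltr0n.
have Q0' : 0 < Q%:R :> R by rewrite ltr0n.
apply: (@le_trans _ _ (q%:R * psi q / Q%:R / Q%:R)).
  by apply: ler_wpM2r; [rewrite invr_ge0 ltW|exact: psi_le_inv].
have -> : q%:R * psi q / Q%:R / Q%:R = psi q / q%:R * (q%:R / Q%:R) ^+ 2.
  by field; rewrite !gt_eqF.
rewrite ler_piMr ?divr_ge0 ?psi_ge0// expr_le1// ?divr_ge0//.
by rewrite ler_pdivrMr// mul1r ler_nat.
Qed.

(** A rational P/Q counted here is within 3r of p/q, so the integer vector qP - Qp is small, and it
    is nonzero as P/Q differs from p/q. For Q in a block [jq, (j+1)q) this vector determines (Q,P)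
    and has entries at most 3(j+1) eps. A block is thus empty while this bound is below 1, and
    otherwise holds O((j eps)^2) rationals; this gap produces the power of eps in the first term.
    The second term pays for the cells hit only because of rounding to the grid. *)
Lemma card_other_rational (p1 p2 : int) (q : nat) (eta h X : R) (M : nat) :
  let eps := q%:R * psi q in let r := psi q / q%:R in
  (0 < q)%N -> primitive p1 p2 q -> 0 < eta <= 1 -> 0 < h <= r -> 0 <= X ->
  M%:R * h <= eta * r / 2 ->
  #|[pred g : 'I_M * 'I_M | `[<exists Q P, [/\ (Q < (Num.truncn X).+1)%N,
      (q <= Q)%N /\ ~ collinear p1 p2 q P Q &
      hits (p1%:~R / q%:R + (1 - eta) * r) (p2%:~R / q%:R) h
        (fun Q => psi Q / Q%:R + h / 2) Q P g]>]]|%:R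
  <= 72 ^+ 2 * (eps ^+ 2 / (q%:R ^+ 2 * h)) ^+ 2
     + (16 ^+ 2 * (X * r) ^+ 2 + 16) * X.
Proof.
move=> eps r q0 prim /andP[eta0 eta1] /andP[h0 hr] X0 Mh.
have q0' : 0 < q%:R :> R by rewrite ltr0n.
set n := (Num.truncn X).+1; set rho := fun Q : nat => _.
have rho0 Q : 0 <= rho Q.
  apply: addr_ge0; last by rewrite divr_ge0// ltW.
  case: Q => [|Q].
    by rewrite invr0 mulr0.
  by rewrite divr_ge0// psi_ge0.
have r0 : 0 < r by exact: lt_le_trans hr.
have eps0 : 0 < eps.
  by have := mulr_gt0 r0 (exprn_gt0 2 q0'); rewrite /r /eps; congr (0 < _); field;
     rewrite gt_eqF.
set a1 := _ + _ * r; set a2 := p2%:~R / _.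
have [L [uL HL]] := @hits_union_bound R a1 a2 h M n rho h0 rho0
  (fun Q P => (q <= Q)%N /\ ~ collinear p1 p2 q P Q).
move=> /le_trans; apply.
have rhoQ Q : (q <= Q)%N -> rho Q <= r + h / 2.
  by move=> qQ; rewrite lerD2r psi_quot_le.
have XQ Q : (Q < n)%N -> Q%:R <= X.
  by rewrite ltnS truncn_ge_nat.
(* With y = psi(Q)/(Qh), a rational hits at most (2y+2)^2 <= 8y^2 + 8 grid points. The constant part
   is summed crudely over each Q, the quadratic part over blocks of length q. *)
apply: (@le_trans _ _ (\sum_(t <- L) 8 * (psi t.1 / (t.1%:R * h)) ^+ 2 +
    \sum_(t <- L) 8)).
  rewrite -big_split /= big_seq [leRHS]big_seq; apply: ler_sum => t /HL[_ [qt _] _].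
  have -> : 2 * rho t.1 / h + 1 = 2 * (psi t.1 / (t.1%:R * h)) + 2.
    rewrite /rho; field; rewrite gt_eqF//= pnatr_eq0.
    by rewrite -lt0n (leq_trans q0).
  set y := psi _ / _; have := sqr_ge0 (y - 1); rewrite !expr2; nra.
apply: lerD; last first.
  have := @sum_by_key R _ L (fun t => t.1) n (fun _ => 8)
    (fun Q => if Q == 0%N then 0 else 2 * (4 * (X * r)) ^+ 2 + 2) (fun=> 8).
  move=> /(_ _ _ _)/le_trans; apply => //.
  - by move=> t /HL[].
  - move=> j jn; case: ifPn => [/eqP->|j0].
      by rewrite filter_nil// => t /HL[_ [qt _] _]; rewrite -lt0n (leq_trans q0).
    have HL' t : t \in L -> exists g : 'I_M * 'I_M, hits a1 a2 h rho t.1 t.2 g.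
      by move=> /HL[].
    case: (leqP q j) => qj; last first.
      rewrite filter_nil; last first.
        by move=> t /HL[_ [qt _] _]; rewrite gtn_eqF// (leq_trans qj).
      by rewrite addr_ge0// mulr_ge0// sqr_ge0.
    apply: le_trans (size_hits_fiber h0 rho0 uL _ HL') _; first by rewrite lt0n.
    have jX := XQ _ jn.
    have : j%:R * (M%:R * h) + 2 * (j%:R * rho j) + 1 <= 4 * (X * r) + 1.
      rewrite lerD2r.
      have -> : 4 * (X * r) = X * r + 2 * (X * (r + r / 2)) by field.
      have Mr : M%:R * h <= r.
        by apply: (le_trans Mh); rewrite mulrAC ler_piMl ?ltW//; lra.
      have rr : rho j <= r + r / 2 by apply: (le_trans (rhoQ _ qj)); lra.
      rewrite lerD ?ler_wpM2l//; first by rewrite ler_pM// mulr_ge0// ltW.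
      by rewrite ler_pM.
    set y := (Y in Y <= _ -> _); have y0 : 0 <= y.
      by rewrite /y !addr_ge0 ?mulr_ge0// ltW.
    move=> yle; apply: (@le_trans _ _ ((4 * (X * r) + 1) ^+ 2)).
      by rewrite ler_sqr ?nnegrE// (le_trans y0).
    by have := sqr_ge0 (4 * (X * r) - 1); rewrite !expr2; nra.
  rewrite -(big_mkord xpredT (fun j => (if j == 0%N then 0 else _) * 8)).
  rewrite big_ltn// eqxx mul0r add0r.
  rewrite (eq_big_nat _ _ (F2 := fun=> (2 * (4 * (X * r)) ^+ 2 + 2) * 8)); last first.
    by move=> j /andP[j0 _]; rewrite gtn_eqF.
  rewrite sumr_const_nat subn1 -[leLHS]mulr_natr.
  have -> : (16 ^+ 2 * (X * r) ^+ 2 + 16) * X =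
    (2 * (4 * (X * r)) ^+ 2 + 2) * 8 * X by ring.
  apply: ler_wpM2l; last by rewrite truncn_le.
  by rewrite mulr_ge0// addr_ge0// mulr_ge0// sqr_ge0.
                                                                                 
                                                                             
                                   
(* The quadratic part: in block j the bound psi(Q) <= eps/Q with Q >= jq gives [c], while the count
   of vectors qP - Qp gives [b]. The product decays like 1/j^2. *)
pose key (t : nat * (int * int)) := (t.1 %/ q)%N.
have keyP t : t \in L -> (0 < key t)%N.
  by move=> /HL[_ [qt _] _]; rewrite divn_gt0.
pose c (j : nat) := 8 * (eps / ((j%:R * q%:R) ^+ 2 * h)) ^+ 2.
pose b (j : nat) := (18 * (j%:R * eps)) ^+ 2.
have := @sum_by_key R _ L key n c b
  (fun t => 8 * (psi t.1 / (t.1%:R * h)) ^+ 2).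
move=> /(_ _ _ _)/le_trans; apply.
- move=> t tL; have [tn [qt _] _] := HL _ tL; split.
    by apply: leq_ltn_trans tn; exact: leq_div.
  have t0 : (0 < t.1)%N by exact: leq_trans qt.
  have k0 : 0 < (key t)%:R :> R by rewrite ltr0n keyP.
  have j0 : 0 < (key t)%:R * q%:R :> R by rewrite mulr_gt0.
  have jt : (key t)%:R * q%:R <= t.1%:R :> R by rewrite -natrM ler_nat leq_trunc_div.
  have t0' : 0 < t.1%:R :> R by rewrite ltr0n.
  rewrite ler_pM2l// ler_sqr ?nnegrE.
  + apply: (@le_trans _ _ (eps / (t.1%:R ^+ 2 * h))).
      have -> : eps / (t.1%:R ^+ 2 * h) = eps / t.1%:R / (t.1%:R * h).
        by field; rewrite !gt_eqF.
      apply: ler_wpM2r; first by rewrite invr_ge0 mulr_ge0// ltW.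
      exact: psi_le_inv.
    rewrite ler_wpM2l ?(ltW eps0)// lef_pV2 ?posrE ?mulr_gt0 ?exprn_gt0//.
    by rewrite ler_pM2r// ler_sqr ?nnegrE// ltW.
  + by rewrite divr_ge0 ?psi_ge0// mulr_ge0// ltW.
  + by rewrite divr_ge0 ?(ltW eps0)// mulr_ge0// ?sqr_ge0// ltW.
- by move=> j _; rewrite /c mulr_ge0// sqr_ge0.
- move=> j jn; have [->|j0] := posnP j.
    by rewrite filter_nil ?sqr_ge0// => t /keyP; rewrite lt0n.
  set Lj := [seq _ <- _ | _].
  pose K := 3 * (j.+1%:R * eps).
  have K0 : 0 <= K by rewrite mulr_ge0// mulr_ge0// ltW.
  pose f (t : nat * (int * int)) : int := q%:Z * t.2.1 - t.1%:Z * p1.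
  pose g (t : nat * (int * int)) : int := q%:Z * t.2.2 - t.1%:Z * p2.
  have boxf t : t \in Lj -> `|(f t)%:~R - 0| <= K /\ `|(g t)%:~R - 0| <= K.
    rewrite mem_filter => /andP[/eqP kt tL].
    have [tn [qt _] [[g1 g2]]] := HL _ tL; rewrite /hits /= => -[H1 H2].
    have t0 : (0 < t.1)%N by exact: leq_trans qt.
    have t0' : 0 < t.1%:R :> R by rewrite ltr0n.
    have tj : t.1%:R <= j.+1%:R * q%:R :> R.
      by rewrite -natrM ler_nat ltnW// -ltn_divLR// -/(key t) kt.
    have aux (P p : int) (y a : R) : `|y - P%:~R / t.1%:R| <= rho t.1 ->
        a = p%:~R / q%:R -> a <= y <= a + r ->
        `|(q%:Z * P - t.1%:Z * p)%:~R - 0| <= K.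
      move=> H aE ya; rewrite subr0 rmorphB !rmorphM /=.
      have -> : q%:Z%:~R * P%:~R - t.1%:Z%:~R * p%:~R =
          (q%:R * t.1%:R) * (P%:~R / t.1%:R - a) :> R.
        by rewrite aE -!pmulrn; field; rewrite !gt_eqF.
      rewrite normrM gtr0_norm ?mulr_gt0//.
      apply: (@le_trans _ _ (q%:R * (j.+1%:R * q%:R) * (3 * r))).
        apply: ler_pM => //.
          by rewrite ler_wpM2l// ltW.
        have := rhoQ _ qt; move: H ya; rewrite !ler_norml.
        move=> /andP[y1 y2] /andP[y3 y4] y5; apply/andP; split; lra.
      rewrite le_eqVlt; apply/orP; left; apply/eqP; rewrite /K /eps /r.
      by field; rewrite gt_eqF.
    have Mg (i : 'I_M) : 0 <= h * (i%:R + 2^-1) <= eta * r / 2.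
      rewrite mulr_ge0 ?addr_ge0 ?(ltW h0)//=; apply: le_trans Mh.
      rewrite mulrC ler_pM2r// (@le_trans _ _ i.+1%:R)//; last by rewrite ler_nat.
      by rewrite -(natr1 i); lra.
    have er : 0 <= eta * r <= r by rewrite mulr_ge0 ?ler_piMl// ltW.
    split; [apply: (aux _ _ _ _ H1 erefl)|apply: (aux _ _ _ _ H2 erefl)].
      rewrite /grid_pt /a1; have := Mg g1.
      move=> /andP[? ?]; move/andP: er => [? ?]; apply/andP; split; lra.
    rewrite /grid_pt /a2; have := Mg g2.
    move=> /andP[? ?]; move/andP: er => [? ?]; apply/andP; split; lra.
  (* If K < 1 both integers [f t] and [g t] vanish, contradicting non-collinearity, so the block is
     empty. If K >= 1 then 2K + 1 <= 3K <= 18 j eps. *)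
  have [Kge|Klt] := leP 1 K; last first.
    rewrite (_ : Lj = [::]) ?sqr_ge0//.
    apply/eqP; rewrite -size_eq0 -leqn0 leqNgt; apply/negP.
    case E : Lj => [//|t s] _; have tL : t \in Lj by rewrite E mem_head.
    have [H1 H2] := boxf _ tL.
    have z0 (z : int) : `|z%:~R - 0 : R| <= K -> z = 0.
      move=> H; apply/eqP; rewrite -normr_le0 -ltz1D addr0.
      by rewrite -(ltr_int R) intr_norm (le_lt_trans _ Klt)// -(subr0 z%:~R).
    move: tL; rewrite mem_filter => /andP[_ /HL[_ [_ ncol] _]].
    by apply: ncol; split; apply/eqP; rewrite -subr_eq0; apply/eqP; exact: z0.
  apply: (@le_trans _ _ ((2 * K + 1) * (2 * K + 1))).
    apply: (size_int_box (f := f) (g := g) _ _ K0 K0 boxf).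
      exact: filter_uniq.
    move=> t t'; rewrite !mem_filter => /andP[/eqP kt tL] /andP[/eqP kt' tL'].
    wlog tt : t t' kt tL kt' tL' / (t.1 <= t'.1)%N.
      by move=> H; case: (leqP t.1 t'.1) => [|/ltnW] tt e;
        [exact: H|apply/esym; apply: H].
    move=> [fe ge].
    have tE : t.1 = t'.1.
      apply/eqP; rewrite eqn_leq tt /= leqNgt; apply/negP => tlt.
      (* Two rationals of one block with equal vectors differ by a vector proportional to (q,p)
         whose denominator is positive and less than q, which primitivity forbids. *)
      apply: (prim (t'.1 - t.1)%N (t'.2.1 - t.2.1) (t'.2.2 - t.2.2)).
      - rewrite subn_gt0 tlt /= ltn_subLR ?(ltnW tlt)//.
        apply: (@leq_trans (j.+1 * q)%N).
          by rewrite -ltn_divLR// -/(key t') kt'.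
        by rewrite mulSn addnC leq_add2r -kt leq_trunc_div.
      - by move: fe; rewrite /f -subzn ?(ltnW tlt)//; clear; lra.
      - by move: ge; rewrite /g -subzn ?(ltnW tlt)//; clear; lra.
    have q0z : q%:Z != 0 by rewrite eqz_nat gtn_eqF.
    move: t t' tE fe ge {kt tL kt' tL' tt} => [Q [x y]] [Q' [x' y']] /= ->.
    by rewrite /f /g /= => /addIr/(mulfI q0z)-> /addIr/(mulfI q0z)->.
  rewrite -expr2 /b ler_sqr ?nnegrE; last 2 first.
  + by rewrite addr_ge0// mulr_ge0.
  + by rewrite mulr_ge0// mulr_ge0// ltW.
  have : K <= 6 * (j%:R * eps).
    rewrite /K mulrA [leRHS]mulrA ler_pM2r// -(natr1 j).
    have : 1 <= j%:R :> R by rewrite ler1n.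
    lra.
  lra.
rewrite -(big_mkord xpredT (fun j => b j * c j)) big_ltn// {1}/b mul0r mulr0.
rewrite expr2 mul0r mul0r add0r.
have -> : 72 ^+ 2 * (eps ^+ 2 / (q%:R ^+ 2 * h)) ^+ 2 =
  36 ^+ 2 * 2 * (eps ^+ 2 / (q%:R ^+ 2 * h)) ^+ 2 * 2 by ring.
set w := 36 ^+ 2 * 2 * _.
apply: (@le_trans _ _ (\sum_(1 <= j < n) w * j%:R ^- 2)).
  rewrite big_nat [leRHS]big_nat; apply: ler_sum => j /andP[j0 _].
  rewrite le_eqVlt; apply/orP; left; apply/eqP; rewrite /w /b /c.
  by field; rewrite !gt_eqF// ltr0n.
have w0 : 0 <= w by apply: mulr_ge0; [apply: mulr_ge0|]; rewrite ?sqr_ge0.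
by rewrite -mulr_sumr ler_wpM2l// sum_inv_sq.
Qed.

End OtherRationals.

(** Each of the five terms is compared with T = (l/h)^2: three get T/32 and two get T/64. The
    numerical constants are what these comparisons demand: 48^2 = 72 * 32 for the main term of small
    denominators, 224^2 >= 81 * 16 * 32 for its lower-order term, and 55^4 >= 16^2 * 8 * 64^2 for
    the terms with foreign rationals. *)
Lemma bad_points_bound (R : realType) (eta r eps l h c m q : R) :
  1 <= c -> 1 <= m -> 0 < q -> 0 < eps <= 1 -> 0 < r -> 0 < eta ->
  r = eps / q ^+ 2 -> l = eta * r / 2 -> h = 4 * c / m ^+ 3 ->
  48 ^+ 2 <= c -> 55 ^+ 2 * c * eps <= eta -> 224 * c <= m * l ->
  9 / 2 * (l ^+ 2 * m ^+ 6 / c ^+ 3) + 81 * (m ^+ 4 / c ^+ 2) +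
  (72 ^+ 2 * (eps ^+ 2 / (q ^+ 2 * h)) ^+ 2
   + (16 ^+ 2 * (2 * eps * m ^+ 2 * r) ^+ 2 + 16) * (2 * eps * m ^+ 2))
  <= (l / h) ^+ 2 / 8.
Proof.
move=> c1 m1 q0 /andP[e0 e1] r0 eta0 rE lE hE hc he hm.
have c0 : 0 < c by lra.
have m0 : 0 < m by lra.
have q0n : q != 0 by rewrite gt_eqF.
have c0n : c != 0 by rewrite gt_eqF.
have m0n : m != 0 by rewrite gt_eqF.
have l0 : 0 < l by rewrite lE divr_gt0 ?mulr_gt0.
have e0n : eps != 0 by rewrite gt_eqF.
pose T := (l / h) ^+ 2; have T0 : 0 <= T by exact: sqr_ge0.
have TE : T = l ^+ 2 * m ^+ 6 / (16 * c ^+ 2).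
  by rewrite /T hE; field; rewrite m0n c0n.
have s1 : 9 / 2 * (l ^+ 2 * m ^+ 6 / c ^+ 3) <= T / 32.
  have -> : 9 / 2 * (l ^+ 2 * m ^+ 6 / c ^+ 3) = T * (72 / c).
    by rewrite TE; field.
  rewrite ler_wpM2l// ler_pdivrMr//; move: hc; rewrite !expr2; lra.
have lm : 224 ^+ 2 * c ^+ 2 <= m ^+ 2 * l ^+ 2.
  by rewrite -!exprMn ler_sqr ?nnegrE ?mulr_ge0// ltW.
have cc : 1 <= c ^+ 2 by rewrite exprn_ege1.
have mm : 1 <= m ^+ 2 by rewrite exprn_ege1.
have s2 : 81 * (m ^+ 4 / c ^+ 2) <= T / 32.
  have -> : T / 32 = m ^+ 4 / c ^+ 2 * (m ^+ 2 * l ^+ 2 / (16 * 32)).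
    by rewrite TE; field.
  rewrite mulrC ler_wpM2l ?divr_ge0 ?exprn_ge0 ?(ltW m0) ?(ltW c0)//.
  move: lm; rewrite (expr2 224); lra.
have eta2 : 55 ^+ 4 * (c ^+ 2 * eps ^+ 2) <= eta ^+ 2.
  have -> : 55 ^+ 4 * (c ^+ 2 * eps ^+ 2) = (55 ^+ 2 * c * eps) ^+ 2 by ring.
  by rewrite ler_sqr ?nnegrE ?mulr_ge0// ?ltW// ?exprn_ge0.
have s3 : 72 ^+ 2 * (eps ^+ 2 / (q ^+ 2 * h)) ^+ 2 <= T / 32.
  have -> : T / 32 = (eps / (q ^+ 2 * h)) ^+ 2 * (eta ^+ 2 / 128).
    by rewrite /T lE rE hE; field; rewrite m0n c0n q0n.
  have -> : 72 ^+ 2 * (eps ^+ 2 / (q ^+ 2 * h)) ^+ 2 =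
    (eps / (q ^+ 2 * h)) ^+ 2 * (72 ^+ 2 * eps ^+ 2).
    by rewrite hE; field; rewrite m0n c0n q0n.
  rewrite ler_wpM2l ?sqr_ge0// ler_pdivlMr//.
  apply: le_trans eta2.
  have : eps ^+ 2 <= c ^+ 2 * eps ^+ 2 by rewrite ler_peMl ?sqr_ge0.
  have := sqr_ge0 eps; rewrite !exprS expr0; nra.
have s4 : 16 ^+ 2 * (2 * eps * m ^+ 2 * r) ^+ 2 * (2 * eps * m ^+ 2) <= T / 64.
  have -> : T / 64 = m ^+ 6 * r ^+ 2 * (eta ^+ 2 / (64 * 64 * c ^+ 2)).
    by rewrite TE lE; field.
  have -> : 16 ^+ 2 * (2 * eps * m ^+ 2 * r) ^+ 2 * (2 * eps * m ^+ 2) =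
    m ^+ 6 * r ^+ 2 * (16 ^+ 2 * 8 * eps ^+ 3) by ring.
  apply: ler_wpM2l; first by rewrite mulr_ge0// exprn_ge0// ltW.
  rewrite ler_pdivlMr; last by rewrite mulr_gt0// exprn_gt0.
  apply: le_trans eta2.
  have : c ^+ 2 * eps ^+ 3 <= c ^+ 2 * eps ^+ 2.
    by rewrite ler_wpM2l ?sqr_ge0// exprS ler_piMl// sqr_ge0.
  have : 0 <= c ^+ 2 * eps ^+ 3 by rewrite mulr_ge0 ?exprn_ge0 ?(ltW c0) ?(ltW e0).
  rewrite (exprS 55) (exprS 55) !(expr2 55) (expr2 16); lra.
have s5 : 16 * (2 * eps * m ^+ 2) <= T / 64.
  have -> : T / 64 = m ^+ 2 * (m ^+ 2 * (m ^+ 2 * l ^+ 2) / (32 * 32 * c ^+ 2)).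
    by rewrite TE; field.
  rewrite [leLHS](_ : _ = m ^+ 2 * (32 * eps)); last by ring.
  rewrite ler_wpM2l ?sqr_ge0// ler_pdivlMr; last by rewrite mulr_gt0// exprn_gt0.
  apply: (@le_trans _ _ (m ^+ 2 * l ^+ 2)); last first.
    by rewrite ler_peMl// mulr_ge0 ?sqr_ge0.
  apply: le_trans lm.
  have : eps * c ^+ 2 <= c ^+ 2 by rewrite ler_piMl ?sqr_ge0.
  rewrite (expr2 224); lra.
rewrite -/T; move: s1 s2 s3 s4 s5; lra.
Qed.

(** * Children of a rational point *)

Section Children.
Context {R : realType}.
Variable psi : nat -> R.
Hypothesis psi_gt0 : forall q, (0 < q)%N -> 0 < psi q.
Hypothesis psi_noninc : forall p q : nat, (0 < p)%N -> (p <= q)%N ->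
  q%:R * psi q <= p%:R * psi p.

Let psi_ge0 q : (0 < q)%N -> 0 <= psi q. Proof. by move=> /psi_gt0/ltW. Qed.

                                                                         
                                                                              
                                                                        
(** The good grid points are those outside both bad sets, and the child attached to one is its
    Dirichlet rational p'/q'. Avoiding small denominators gives q' > m^2/C, hence p'/q' and its
    approximation square stay within h/4 of the grid point and of p'/q' respectively. Foreign
    denominators up to X are then excluded by the choice of the grid point, larger ones by repulsion
    from p'/q'. *)
Lemma exists_children (p1 p2 : int) (q : nat) (eta : R) (C m : nat) :
  let eps := q%:R * psi q in let r := psi q / q%:R in
  let l := eta * r / 2 in let h := 4 * C%:R / m%:R ^+ 3 in
  let M := Num.truncn (l / h) in
  let a1 := p1%:~R / q%:R + (1 - eta) * r in let a2 := p2%:~R / q%:R in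
  (0 < q)%N -> primitive p1 p2 q -> 0 < eta <= 1 ->
  48 ^+ 2 <= C%:R :> R -> 55 ^+ 2 * C%:R * eps <= eta ->
  224 * C%:R <= m%:R * l -> 4 * h <= l -> (C <= m)%N ->
  (forall Q, (m ^ 2 <= C * Q)%N -> Q%:R * psi Q <= 2^-1) ->
  exists A : pred ('I_M * 'I_M), (l / h) ^+ 2 / 8 <= #|A|%:R /\
    forall g, A g -> exists (p1' p2' : int) (q' : nat),
    [/\ primitive p1' p2' q', (0 < q' <= m ^ 2)%N, (m ^ 2 < C * q')%N,
     `|grid_pt h a1 g.1 - p1'%:~R / q'%:R| <= h / 4 /\
     `|grid_pt h a2 g.2 - p2'%:~R / q'%:R| <= h / 4 &
     forall Q P x1 x2, (q <= Q < q')%N -> ~ collinear p1 p2 q P Q ->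
      `|x1 - p1'%:~R / q'%:R| <= psi q' / q'%:R ->
      `|x2 - p2'%:~R / q'%:R| <= psi q' / q'%:R ->
      ~ (`|x1 - P.1%:~R / Q%:R| < psi Q / Q%:R /\
         `|x2 - P.2%:~R / Q%:R| < psi Q / Q%:R)].
Proof.
move=> eps r l h M a1 a2 q0 prim eta01 HC He Hm Hl Cm Hpsi.
have q0' : 0 < q%:R :> R by rewrite ltr0n.
have C0' : 0 < C%:R :> R by apply: lt_le_trans HC; rewrite exprn_gt0.
have C0 : (0 < C)%N by rewrite ltr0n in C0'.
have m0 : (0 < m)%N by exact: leq_trans Cm.
have m0' : 0 < m%:R :> R by rewrite ltr0n.
have h0 : 0 < h by rewrite divr_gt0 ?exprn_gt0// mulr_gt0.
have r0 : 0 < r by rewrite divr_gt0// psi_gt0.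
have eps0 : 0 < eps by rewrite mulr_gt0// psi_gt0.
have /andP[eta0 eta1] := eta01.
have C1 : 1 <= C%:R :> R by rewrite ler1n.
have m1 : 1 <= m%:R :> R by rewrite ler1n.
have eps1 : eps <= 1.
  apply: le_trans eta1; apply: le_trans He; rewrite ler_peMl ?(ltW eps0)//.
  by rewrite mulr_ege1// exprn_ege1// ler1n.
have l0 : 0 < l by rewrite divr_gt0// mulr_gt0.
have Mh : M%:R * h <= l by rewrite -ler_pdivlMr// truncn_le divr_ge0// ltW.
(* From this threshold on, q' psi(Q) <= m^2 eps/Q <= 1/2, which is half of what repulsion
   requires. *)
pose X := 2 * eps * m%:R ^+ 2.
have X0 : 0 < X by rewrite mulr_gt0 ?exprn_gt0// mulr_gt0.
have hr : 0 < h <= r.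
  rewrite h0 /=.
  have : l <= r by rewrite /l mulrAC ler_piMl ?(ltW r0)//; lra.
  lra.
set n1 := (m ^ 2 %/ C).+1; set n2 := (Num.truncn X).+1.
pose rho1 (Q : nat) := (Q%:R * m%:R)^-1 : R.
pose rho2 (Q : nat) := psi Q / Q%:R + h / 2.
pose bad1 := [pred g : 'I_M * 'I_M | `[<exists Q P,
      [/\ (Q < n1)%N, (0 < Q)%N & hits a1 a2 h rho1 Q P g]>]].
pose bad2 := [pred g : 'I_M * 'I_M | `[<exists Q P, [/\ (Q < n2)%N,
      (q <= Q)%N /\ ~ collinear p1 p2 q P Q & hits a1 a2 h rho2 Q P g]>]].
have cb1 := card_small_denominator a1 a2 C0 m0 (erefl h) Mh.
have cb2 := card_other_rational psi_ge0 psi_noninc q0 prim eta01 hr (ltW X0) Mh.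
rewrite -/bad1 in cb1; rewrite -/bad2 in cb2.
exists [predC [predU bad1 & bad2]]; split.
  (* Truncation loses less than 1 out of l/h >= 4. At least 9/16 - 1/8 of (l/h)^2 then survives,
     more than the 1/8 claimed. *)
  have MT : (3 / 4) * (l / h) <= M%:R.
    have l4 : 4 <= l / h by rewrite ler_pdivlMr.
    have := truncn_itv (le_trans (ler0n _ 4) l4) => /andP[_].
    rewrite -/M -(natr1 M); lra.
  have M2 : (9 / 16) * (l / h) ^+ 2 <= M%:R ^+ 2.
    have -> : (9 / 16) * (l / h) ^+ 2 = (3 / 4 * (l / h)) ^+ 2.
      by set t := l / h; field.
    by rewrite ler_sqr ?nnegrE// mulr_ge0// divr_ge0// ltW.
  have eps01 : 0 < eps <= 1 by rewrite eps0.
  have rE : r = eps / q%:R ^+ 2 by rewrite /r /eps; field; rewrite gt_eqF.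
  have bb := bad_points_bound C1 m1 q0' eps01 r0 eta0 rE erefl erefl HC He Hm.
  have {}bb : #|bad1|%:R + #|bad2|%:R <= (l / h) ^+ 2 / 8 :> R.
    by apply: le_trans bb; exact: lerD cb1 cb2.
  have : (M ^ 2 <= #|[predC [predU bad1 & bad2]]| + (#|bad1| + #|bad2|))%N.
    rewrite -{1}[M]card_ord expnS expn1 -card_prod.
    rewrite -(cardC [predU bad1 & bad2]) addnC leq_add2l.
    by rewrite -(cardUI bad1 bad2) leq_addr.
  rewrite -(ler_nat R) !natrD natrX.
  have : 0 <= (l / h) ^+ 2 by exact: sqr_ge0.
  lra.
move=> g; rewrite /= negb_or => /andP[/asboolPn nb1 /asboolPn nb2].
have [q' [P1 [P2 [/andP[q'0 q'm] prim' d1 d2]]]] :=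
  dirichlet_primitive (grid_pt h a1 g.1) (grid_pt h a2 g.2) m0.
have q'0' : 0 < q'%:R :> R by rewrite ltr0n.
have near1 (x : R) (P : int) : `|q'%:R * x - P%:~R| < m%:R^-1 ->
    `|x - P%:~R / q'%:R| <= rho1 q'.
  move=> H; have -> : x - P%:~R / q'%:R = (q'%:R * x - P%:~R) / q'%:R.
    by field; rewrite gt_eqF.
  rewrite normrM [`|q'%:R^-1|]gtr0_norm ?invr_gt0// /rho1 invfM mulrC.
  by rewrite ler_pM2l ?invr_gt0// ltW.
have {d1}d1 := near1 _ _ d1; have {d2}d2 := near1 _ _ d2.
have Cq' : (m ^ 2 < C * q')%N.
  rewrite mulnC -ltn_divLR// ltnNge; apply/negP => q'n; apply: nb1.
  by exists q', (P1, P2); split.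
have Cq'R : m%:R ^+ 2 < C%:R * q'%:R :> R by rewrite -natrX -natrM ltr_nat.
have rho1h : rho1 q' <= h / 4.
  rewrite /rho1 -[leLHS]mul1r ler_pdivrMr ?mulr_gt0//.
  have -> : h / 4 * (q'%:R * m%:R) = C%:R * q'%:R / m%:R ^+ 2.
    by rewrite /h; field; rewrite gt_eqF.
  by rewrite ler_pdivlMr ?exprn_gt0// mul1r ltW.
have Hq' := Hpsi _ (ltnW Cq').
have psiq' : psi q' / q'%:R <= h / 4.
  apply: (@le_trans _ _ (2^-1 / q'%:R ^+ 2)).
    have -> : psi q' / q'%:R = q'%:R * psi q' / q'%:R ^+ 2.
      by field; rewrite gt_eqF.
    by rewrite ler_pM2r// invr_gt0 exprn_gt0.
  rewrite ler_pdivrMr ?exprn_gt0//.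
  have -> : h / 4 * q'%:R ^+ 2 = (C%:R * q'%:R) ^+ 2 / (C%:R * m%:R ^+ 3).
    by rewrite /h; field; rewrite !gt_eqF.
  rewrite ler_pdivlMr ?mulr_gt0 ?exprn_gt0//.
  apply: (@le_trans _ _ ((m%:R ^+ 2) ^+ 2)).
    have -> : (m%:R ^+ 2) ^+ 2 = m%:R * m%:R ^+ 3 :> R by ring.
    rewrite mulrA ler_pM2r ?exprn_gt0//.
    have : C%:R <= m%:R :> R by rewrite ler_nat.
    lra.
  by rewrite ler_sqr ?nnegrE ?sqr_ge0 ?mulr_ge0// ltW.
exists P1, P2, q'; split => //; first by rewrite q'0.
  by split; [exact: le_trans d1 rho1h|exact: le_trans d2 rho1h].
move=> Q [S1 S2] x1 x2 /andP[qQ Qq'] ncol hx1 hx2 /= [c1 c2].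
have Q0 : (0 < Q)%N by exact: leq_trans qQ.
have Q0' : 0 < Q%:R :> R by rewrite ltr0n.
have [Qn|nQ] := ltnP Q n2.
  apply: nb2; exists Q, (S1, S2); split => //=.
  have tri (x y z w : R) : `|x - y| <= rho1 q' -> `|z - y| <= psi q' / q'%:R ->
      `|z - w| < psi Q / Q%:R -> `|x - w| <= rho2 Q.
    rewrite /rho2 !ler_norml !ltr_norml => /andP[? ?] /andP[? ?] /andP[? ?].
    apply/andP; split; lra.
  by split; [exact: tri d1 hx1 c1|exact: tri d2 hx2 c2].
have XQ : X < Q%:R.
  by have /andP[_ /lt_le_trans] := truncn_itv (ltW X0); apply; rewrite ler_nat.
(* Repulsion: q' psi(Q) and Q psi(q') are both at most 1/2, so each integer q'S - QP has absolute
   value below 1 and vanishes. The foreign rational would be p'/q' written with the smaller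
   denominator Q, against [prim']. *)
suff zero (x : R) (P S : int) : `|x - P%:~R / q'%:R| <= psi q' / q'%:R ->
    `|x - S%:~R / Q%:R| < psi Q / Q%:R -> q'%:Z * S = Q%:Z * P.
  apply: (prim' Q S1 S2); first by rewrite Q0 Qq'.
    exact: zero hx1 c1.
  exact: zero hx2 c2.
move=> H1 H2; apply/eqP; rewrite -subr_eq0 -normr_le0 -ltz1D addr0 -(ltr_int R).
rewrite intr_norm rmorphB !rmorphM /=.
have -> : q'%:Z%:~R * S%:~R - Q%:Z%:~R * P%:~R =
    q'%:R * Q%:R * (S%:~R / Q%:R - P%:~R / q'%:R) :> R.
  by rewrite -!pmulrn; field; rewrite !gt_eqF.
rewrite normrM gtr0_norm ?mulr_gt0// mulr1z.
apply: (@lt_le_trans _ _ (q'%:R * Q%:R * (psi Q / Q%:R + psi q' / q'%:R))).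
  rewrite ltr_pM2l ?mulr_gt0//; move: H1 H2.
  by rewrite ler_norml !ltr_norml => /andP[? ?] /andP[? ?]; apply/andP; split; lra.
have -> : q'%:R * Q%:R * (psi Q / Q%:R + psi q' / q'%:R) =
  q'%:R * psi Q + Q%:R * psi q' by field; rewrite !gt_eqF.
have : Q%:R * psi q' <= q'%:R * psi q'.
  by rewrite ler_wpM2r ?psi_ge0// ler_nat ltnW.
suff : q'%:R * psi Q <= 2^-1 by lra.
apply: (@le_trans _ _ (m%:R ^+ 2 * (eps / X))).
  apply: ler_pM => //; first exact: psi_ge0.
    by rewrite -natrX ler_nat.
  apply: (le_trans (psi_le_inv psi_noninc q0 qQ)); rewrite -/eps.
  by rewrite ler_pM2l// lef_pV2 ?posrE// ltW.
rewrite le_eqVlt; apply/orP; left; apply/eqP; rewrite /X.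
by field; rewrite !gt_eqF.
Qed.

End Children.

                                          

(** * Hausdorff content and diameters *)

Lemma powR_le1 (R : realType) (y e : R) : 0 <= y <= 1 -> 0 <= e -> y `^ e <= 1.
Proof.
move=> /andP[y0 y1] e0; have -> : 1 = 1 `^ e by rewrite powR1.
by rewrite ge0_ler_powR// nnegrE.
Qed.

Lemma powR_ge1 (R : realType) (y e : R) : 1 <= y -> 0 <= e -> 1 <= y `^ e.
Proof.
move=> y1 e0; have -> : 1 = 1 `^ e by rewrite powR1.
by apply: ge0_ler_powR => //; rewrite nnegrE ?ler01// (le_trans ler01).
Qed.

Lemma powR_divr (R : realType) (x y e : R) : 0 <= x -> 0 < y ->
  (x / y) `^ e = x `^ e / y `^ e.
Proof.
move=> x0 y0; rewrite powRM ?invr_ge0 ?(ltW y0)//; congr (_ * _).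
by rewrite -powR_inv1 ?(ltW y0)// -powRrM mulN1r powRN.
Qed.

Section HausdorffFacts.
Context {R : realType} {V : normedModType R}.
Implicit Types (A B : set V) (U : nat -> set V) (s d : R).

Lemma diam_ge0 B : (0 <= diam B)%E.
Proof. by apply: ereal_sup_ubound; left. Qed.

Lemma diam_le B d : 0 <= d -> (forall x y, B x -> B y -> `|x - y| <= d) ->
  (diam B <= d%:E)%E.
Proof.
move=> d0 H; apply: ge_ereal_sup => _ [->|[[x y] [/= Bx By] <-]].
  by rewrite lee_fin.
by rewrite lee_fin; exact: H.
Qed.

Lemma dist_le_diam B x y : B x -> B y -> (`|x - y|%:E <= diam B)%E.
Proof. by move=> Bx By; apply: ereal_sup_ubound; right; exists (x, y). Qed.

Lemma diam_fin B d : (diam B <= d%:E)%E ->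
  exists t, [/\ 0 <= t <= d, diam B = t%:E &
    forall x y, B x -> B y -> `|x - y| <= t].
Proof.
move=> Bd; have := diam_ge0 B; have := @dist_le_diam B.
case: (diam B) Bd => [t| |] //; rewrite lee_fin => td H t0.
exists t; split => //; first by rewrite -lee_fin t0.
Qed.

Lemma diam_pow_ge0 s B : (0 <= diam_pow s B)%E.
Proof. by rewrite /diam_pow; case: ifP => // _; exact: poweR_ge0. Qed.

Lemma diam_pow_EFin s B t : B !=set0 -> diam B = t%:E ->
  diam_pow s B = (t `^ s)%:E.
Proof.
by move=> /set0P/negPf B0 dB; rewrite /diam_pow B0 dB poweR_EFin.
Qed.

Lemma diam_pow_le s d B : 0 <= s -> 0 <= d ->
  (forall x y, B x -> B y -> `|x - y| <= d) -> (diam_pow s B <= (d `^ s)%:E)%E.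
Proof.
move=> s0 d0 H; have [t [/andP[t0 td] dB _]] := diam_fin (diam_le d0 H).
rewrite /diam_pow; case: ifP => _; first by rewrite lee_fin powR_ge0.
by rewrite dB poweR_EFin lee_fin ge0_ler_powR.
Qed.

Lemma diam_pow_anti s s' B : 0 <= s <= s' -> (diam B <= 1%:E)%E ->
  (diam_pow s' B <= diam_pow s B)%E.
Proof.
move=> /andP[s0 ss'] B1; rewrite /diam_pow; case: ifP => // B0.
have [t [/andP[t0 t1] -> _]] := diam_fin B1; rewrite !poweR_EFin lee_fin.
have [->|t_neq0] := eqVneq t 0.
  have [s'0|s'0] := eqVneq s' 0; last by rewrite powR0// powR_ge0.
  by have -> : s = s' by apply/le_anti; rewrite ss' s'0 s0.
have -> : t `^ s' = t `^ s * t `^ (s' - s).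
  by rewrite -powRD; [rewrite addrC subrK|exact/implyP].
by rewrite ler_piMr ?powR_ge0// powR_le1 ?subr_ge0// t0.
Qed.

(** Covering sets of diameter at most 1 cost no less at the smaller exponent s, so a positive lower
    bound for the content at s' passes to every s <= s'. *)
Lemma hausdorff_measure_neq0 s s' (c : R) A : 0 <= s <= s' -> 0 < c ->
  (c%:E <= hausdorff_content s' 1 A)%E -> hausdorff_measure s A <> 0%E.
Proof.
move=> ss' c0 cA m0.
suff : (c%:E <= hausdorff_measure s A)%E by rewrite m0 lee_fin leNgt c0.
apply: (@le_trans _ _ (hausdorff_content s 1 A)); last first.
  by apply: ereal_sup_ubound; exists 1 => //=.
apply: (le_trans cA); apply: le_ereal_inf_tmp => _ [U [AU dU] <-].
apply: (@le_trans _ _ (\sum_(0 <= i <oo) diam_pow s' (U i))%E).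
  by apply: ge_ereal_inf; exists (\sum_(0 <= i <oo) diam_pow s' (U i))%E => //;
    exists U.
apply: lee_nneseries => i _; first by move=> _; exact: diam_pow_ge0.
exact: diam_pow_anti.
Qed.

End HausdorffFacts.

(** * Lower bound for the content of a tree-like Cantor set *)

Section Cantor.
Context {R : realType} {V : normedModType R} {T : choiceType}.
Variables (box : nat -> T -> set V) (ch : nat -> T -> seq T).
Variables (ok : nat -> T -> Prop) (root : T).
Variables (n : nat -> nat) (l : nat -> R) (kap s : R).
Hypothesis ok_root : ok 0 root.
Hypothesis ok_ch : forall k v w, ok k v -> w \in ch k v -> ok k.+1 w.
Hypothesis size_ch : forall k v, ok k v -> size (ch k v) = n k.
Hypothesis box_ch : forall k v w, ok k v -> w \in ch k v ->
  box k.+1 w `<=` box k v.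
Hypothesis box_neq0 : forall k v, ok k v -> box k v !=set0.
Hypothesis box_small : forall e : R, 0 < e -> exists J, forall k v,
  (J <= k)%N -> ok k v ->
  forall x y, box k v x -> box k v y -> `|x - y| <= e.
Hypothesis l_gt0 : forall k, 0 < l k.
Hypothesis l_small : forall e : R, 0 < e -> exists J, forall k,
  (J <= k)%N -> l k <= e.
Hypothesis l0_le1 : l 0 <= 1.
Hypothesis kap_ge1 : 1 <= kap.
Hypothesis s_gt0 : 0 < s.
Hypothesis s_le2 : s <= 2.

Definition branch (v : nat -> T) : Prop :=
  v 0%N = root /\ forall k, v k.+1 \in ch k (v k).

Definition branch_limit (x : V) : Prop :=
  exists v, branch v /\ forall k, box k (v k) x.

Hypothesis branch_complete : forall v, branch v ->
  exists x, forall k, box k (v k) x.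

Definition meets (U : set V) (k : nat) (v : T) : bool :=
  `[<box k v `&` U !=set0>].

(** The children of a node are spread evenly, up to the factor [kap], over a planar region of size
    [l k]: unless U is so small that it sees a single child, it sees no more than its share by
    area. *)
Hypothesis count_ch : forall k v (U : set V) (rho : R), ok k v -> 0 < rho ->
  (forall x y, U x -> U y -> `|x - y| <= rho) ->
  (count (meets U k.+1) (ch k v) <= 1)%N \/
  (count (meets U k.+1) (ch k v))%:R <= kap * (rho / l k) ^+ 2 * (n k)%:R.
Hypothesis mass : forall k, 1 <= (n k)%:R * l k.+1 `^ s.

Fixpoint desc (k i : nat) (v : T) : seq T :=
  if i is i'.+1 then flatten [seq desc k.+1 i' w | w <- ch k v] else [:: v].

Let N (k : nat) : R := \prod_(0 <= i < k) (n i)%:R.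

Let n_gt0 k : 0 < (n k)%:R :> R.
Proof.
rewrite lt_neqAle ler0n andbT eq_sym; apply/eqP => nk0.
by have := mass k; rewrite nk0 mul0r; lra.
Qed.

Let N_ge1 k : 1 <= N k.
Proof.
rewrite /N; elim: k => [|k IH]; first by rewrite big_geq.
rewrite big_nat_recr//= mulr_ege1//.
by have := n_gt0 k; rewrite ltr0n ler1n.
Qed.

Let l0_pow : 1 <= l 0 `^ (- s).
Proof.
rewrite powRN invf_ge1 ?powR_gt0// powR_le1 ?l0_le1 ?andbT ?(ltW (l_gt0 0))//.
exact: ltW.
Qed.

(** By [mass] the last factor of N alone compensates [l k]; the other factors are at least 1. The
    power of [l 0] takes care of level 0. *)
Let N_mass k : 1 <= N k * l k `^ s * l 0 `^ (- s).
Proof.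
case: k => [|k].
  rewrite /N big_geq// mul1r -powRD ?subrr ?powRr0//.
  by apply/implyP => _; rewrite gt_eqF.
rewrite /N big_nat_recr//= -/(N k) -(mulrA (N k)) mulr_ege1//.
by rewrite mulr_ege1// N_ge1.
Qed.

Lemma ok_desc k i v w : ok k v -> w \in desc k i v -> ok (k + i) w.
Proof.
elim: i k v => [|i IH] k v okv /=; first by rewrite inE addn0 => /eqP ->.
move=> /flattenP[_ /mapP[u uv ->] wu]; rewrite addnS -addSn.
exact: IH (ok_ch okv uv) wu.
Qed.

Lemma box_desc k i v w : ok k v -> w \in desc k i v ->
  box (k + i) w `<=` box k v.
Proof.
elim: i k v => [|i IH] k v okv /=; first by rewrite inE addn0 => /eqP ->.
move=> /flattenP[_ /mapP[u uv ->] wu]; rewrite addnS -addSn.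
exact: subset_trans (IH _ _ (ok_ch okv uv) wu) (box_ch okv uv).
Qed.

Lemma desc_recr k i v w : w \in desc k i.+1 v ->
  exists2 u, u \in desc k i v & w \in ch (k + i) u.
Proof.
elim: i k v => [|i IH] k v.
  move=> /flattenP[_ /mapP[u uv ->] /=]; rewrite inE => /eqP ->.
  by exists v; rewrite ?inE// addn0.
move=> /flattenP[_ /mapP[u uv ->] /IH[u' u'd wu']]; exists u'.
  by apply/flattenP; exists (desc k.+1 i u) => //; apply/mapP; exists u.
by rewrite addnS -addSn.
Qed.

Lemma size_desc k i v : ok k v ->
  (size (desc k i v))%:R * N k = N (k + i).
Proof.
elim: i k v => [|i IH] k v okv /=; first by rewrite addn0 mul1r.
rewrite size_flatten sumnE /shape -map_comp big_map natr_sum.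
rewrite mulr_suml (eq_big_seq (fun=> N (k.+1 + i) / (n k)%:R)).
  rewrite big_const_seq count_predT iter_addr_0 size_ch// -[LHS]mulr_natr addSnnS.
  by rewrite divfK// gt_eqF.
move=> w wv /=; rewrite -(IH _ _ (ok_ch okv wv)) /N big_nat_recr//=.
by rewrite mulrA mulfK// gt_eqF.
Qed.

(** Interpolation between the trivial bound and the area bound: y^2 <= y^s for y <= 1, as s <= 2,
    and 1 <= y^s for y > 1. *)
Lemma pow_min y : 0 < y -> Num.min 1 (kap * y ^+ 2) <= kap * y `^ s.
Proof.
move=> y0; have k0 : 0 < kap by exact: lt_le_trans kap_ge1.
have [y1|y1] := leP y 1.
  rewrite ge_min; apply/orP; right; rewrite ler_pM2l//.
  have -> : y ^+ 2 = y `^ s * y `^ (2 - s).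
    rewrite -powRD; first by rewrite addrC subrK powR_mulrn ?ltW.
    by apply/implyP => _; rewrite gt_eqF.
  by rewrite ler_piMr ?powR_ge0// powR_le1 ?subr_ge0// y1 ltW.
rewrite ge_min; apply/orP; left; apply: mulr_ege1 => //.
by rewrite powR_ge1// ltW.
Qed.

(** The counting form of mass(U) <= const * rho^s. Induction on depth: while U meets at most one
    child, pass to that child. At the first level where it meets more, [count_ch] and [pow_min]
    bound the children met by n_k kap (rho/l_k)^s, all their descendants are counted, and [N_mass]
    absorbs l_k^(-s). If this never happens, rho >= l_(k+i) makes the bound at least 1. *)
Lemma count_desc k i v (U : set V) rho : ok k v -> 0 < rho ->
  (forall x y, U x -> U y -> `|x - y| <= rho) -> l (k + i) <= rho ->
  (count (meets U (k + i)) (desc k i v))%:R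
    <= N (k + i) * (kap * l 0 `^ (- s) * rho `^ s).
Proof.
move=> okv rho0 HU; elim: i k v okv => [|i IH] k v okv lrho.
  apply: (@le_trans _ _ 1); first by rewrite /= addn0 lern1; case: meets.
  rewrite addn0 in lrho *.
  have -> : N k * (kap * l 0 `^ (- s) * rho `^ s) =
    kap * (N k * rho `^ s * l 0 `^ (- s)) by ring.
  apply: mulr_ege1 => //; apply: le_trans (N_mass k) _.
  rewrite ler_pM2r ?powR_gt0// ler_pM2l ?(lt_le_trans _ (N_ge1 k))//.
  by rewrite ge0_ler_powR// ?nnegrE// ?(ltW s_gt0) ?(ltW (l_gt0 _)) ?(ltW rho0).
set B := N _ * _.
rewrite /= count_flatten sumnE -map_comp big_map natr_sum.
have zero w : w \in ch k v -> ~~ meets U k.+1 w ->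
    count (meets U (k + i.+1)) (desc k.+1 i w) = 0%N.
  move=> wv /asboolPn nm; apply/eqP; rewrite -leqn0 leqNgt -has_count.
  apply/hasPn => u uw; apply/asboolPn => -[x [bx Ux]]; apply: nm; exists x.
  split=> //; rewrite addnS -addSn in bx.
  exact: (box_desc (ok_ch okv wv) uw).
rewrite (bigID (meets U k.+1)) /= addrC big_seq_cond big1 ?add0r; last first.
  by move=> w /andP[wv nm]; rewrite zero.
have [c1|c2] := count_ch okv rho0 HU.
  apply: (@le_trans _ _ (\sum_(w <- ch k v | meets U k.+1 w) B)).
    rewrite big_seq_cond [leRHS]big_seq_cond; apply: ler_sum => w /andP[wv _].
    rewrite /B addnS -addSn; apply: IH; first exact: ok_ch wv.
    by rewrite addSn -addnS.
  rewrite -big_filter big_const_seq count_predT iter_addr_0 -mulr_natl size_filter.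
  rewrite ler_piMl ?lern1// mulr_ge0 ?(le_trans _ (N_ge1 _))//.
  by rewrite mulr_ge0 ?mulr_ge0 ?powR_ge0// (le_trans _ kap_ge1).
(* The number of descendants, at the final level, of a single child of v. *)
pose S : R := N (k + i.+1) / (N k * (n k)%:R).
have NS : N (k + i.+1) = N k * (n k)%:R * S.
  rewrite /S mulrC divfK// mulf_neq0// gt_eqF//.
  exact: lt_le_trans (N_ge1 k).
have S0 : 0 <= S.
  by rewrite divr_ge0 ?mulr_ge0 ?(le_trans _ (N_ge1 _)).
apply: (@le_trans _ _ (\sum_(w <- ch k v | meets U k.+1 w) S)).
  rewrite big_seq_cond [leRHS]big_seq_cond; apply: ler_sum => w /andP[wv _].
  rewrite /S ler_pdivlMr ?mulr_gt0 ?(lt_le_trans _ (N_ge1 k))//.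
  rewrite addnS -addSn -(size_desc i (ok_ch okv wv)) /N big_nat_recr//=.
  by rewrite ler_pM2r ?ler_nat ?count_size// mulr_gt0// (lt_le_trans _ (N_ge1 k)).
rewrite -big_filter big_const_seq count_predT iter_addr_0 -mulr_natl size_filter.
pose y := rho / l k; have y0 : 0 < y by rewrite divr_gt0.
set c := (count _ _)%:R.
have cn : c <= (n k)%:R * (kap * y `^ s).
  apply: (@le_trans _ _ ((n k)%:R * Num.min 1 (kap * y ^+ 2))); last first.
    by rewrite ler_pM2l// pow_min.
  rewrite minr_pMr ?(ltW (n_gt0 k))// mulr1 le_min.
  by rewrite [X in _ && (_ <= X)]mulrC c2 andbT -(size_ch okv) ler_nat count_size.
apply: (@le_trans _ _ ((n k)%:R * (kap * y `^ s) * S)); first by rewrite ler_wpM2r.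
rewrite /B NS.
rewrite powR_divr ?(ltW rho0)//.
have -> : (n k)%:R * (kap * (rho `^ s / l k `^ s)) * S =
  (n k)%:R * S * kap * rho `^ s * (l k `^ s)^-1 by ring.
have -> : N k * (n k)%:R * S * (kap * l 0 `^ (- s) * rho `^ s) =
  (n k)%:R * S * kap * rho `^ s * (N k * l 0 `^ (- s)) by ring.
rewrite ler_wpM2l//.
  rewrite mulr_ge0 ?powR_ge0// mulr_ge0 ?(le_trans _ kap_ge1)//.
  by rewrite mulr_ge0.
rewrite -[leLHS]mul1r ler_pdivrMr ?powR_gt0//.
by apply: le_trans (N_mass k) _; rewrite le_eqVlt; apply/orP; left; apply/eqP; ring.
Qed.

(** Some finite generation below v is covered, box by box, by finitely many of the W a; I bounds the
    indices used. *)
Definition eventually_in (W : nat -> set V) (k : nat) (v : T) : Prop :=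
  exists i I, forall w, w \in desc k i v ->
    exists2 a, (a <= I)%N & box (k + i) w `<=` W a.

Lemma eventually_deepen (W : nat -> set V) k v i d I : ok k v ->
  (forall x, x \in desc k i v ->
    exists2 a, (a <= I)%N & box (k + i) x `<=` W a) ->
  forall x, x \in desc k (i + d) v ->
    exists2 a, (a <= I)%N & box (k + (i + d)) x `<=` W a.
Proof.
move=> okv HI; elim: d => [|d IHd]; first by rewrite addn0.
rewrite addnS => x /desc_recr[y yd xy]; have [a aI ya] := IHd y yd.
exists a => //; apply: subset_trans ya.
by rewrite addnS; apply: box_ch xy; exact: ok_desc yd.
Qed.

Lemma eventually_in_ch (W : nat -> set V) k v : ok k v ->
  (forall w, w \in ch k v -> eventually_in W k.+1 w) -> eventually_in W k v.
Proof.
move=> okv H.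
suff [i [I HI]] : exists i I, forall w, w \in ch k v -> forall u,
    u \in desc k.+1 i w -> exists2 a, (a <= I)%N & box (k.+1 + i) u `<=` W a.
  exists i.+1, I => u /flattenP[_ /mapP[w wv ->] uw].
  by rewrite addnS -addSn; exact: HI wv _ uw.
have {H} : forall w, w \in ch k v -> ok k.+1 w /\ eventually_in W k.+1 w.
  by move=> w wv; split; [exact: ok_ch wv|exact: H].
elim: (ch k v) => [|w r IH] H; first by exists 0%N, 0%N.
have [|i [I HI]] := IH; first by move=> u ur; apply: H; rewrite inE ur orbT.
have [okw [i' [I' HI']]] : ok k.+1 w /\ eventually_in W k.+1 w.
  by apply: H; rewrite mem_head.
exists (i' + i)%N, (maxn I' I) => u; rewrite inE => /orP[/eqP ->|ur] x xu.
  have [a aI xa] := eventually_deepen okw HI' xu.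
  by exists a => //; rewrite leq_max aI.
have oku : ok k.+1 u by have [] := H u; rewrite ?inE ?ur ?orbT.
rewrite addnC in xu *.
have [a aI xa] := eventually_deepen oku (HI u ur) xu.
by exists a => //; rewrite leq_max aI orbT.
Qed.

                                                                    
(** Compactness in the form of König's lemma. If the root failed, some child would fail, then a
    grandchild, and so on along a branch; but the limit point of that branch is interior to some W
    a, which contains the boxes of the branch from some level on. *)
Lemma eventually_in_root (W : nat -> set V) :
  (forall x, branch_limit x -> exists a (e : R), 0 < e /\
    forall y, `|x - y| <= e -> W a y) ->
  eventually_in W 0 root.
Proof.
move=> HW; apply: contrapT => bad.
pose step k v := xget v [set w | w \in ch k v /\ ~ eventually_in W k.+1 w].
have stepP k v : ok k v -> ~ eventually_in W k v ->
    step k v \in ch k v /\ ~ eventually_in W k.+1 (step k v).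
  move=> okv nv; suff [w Hw] : exists w, w \in ch k v /\ ~ eventually_in W k.+1 w.
    exact: (@xgetPex _ v [set w | w \in ch k v /\ ~ eventually_in W k.+1 w]
      (ex_intro _ w Hw)).
  apply: contrapT => nw; apply: nv; apply: eventually_in_ch => // w wv.
  by apply: contrapT => nw'; apply: nw; exists w.
pose fix br k := if k is k'.+1 then step k' (br k') else root.
have brP k : ok k (br k) /\ ~ eventually_in W k (br k).
  elim: k => [//|k [okk nk]] /=; have [? ?] := stepP _ _ okk nk.
  by split=> //; exact: ok_ch (br k) _ okk _.
have brB : branch br.
  by split=> // k; have [okk nk] := brP k; have [] := stepP _ _ okk nk.
have [x Hx] := branch_complete brB.
have [|a [e [e0 He]]] := HW x; first by exists br.
have [J HJ] := box_small e0; have [okJ nJ] := brP J; apply: nJ.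
exists 0%N, a => w; rewrite /= inE addn0 => /eqP ->; exists a => //.
by move=> y Jy; apply: He; exact: HJ (leqnn J) okJ _ _ (Hx J) Jy.
Qed.

Lemma sum_halves (m : nat) : \sum_(a < m) (2 ^- a.+1 : R) <= 1.
Proof.
suff -> : \sum_(a < m) (2 ^- a.+1 : R) = 1 - 2 ^- m.
  by rewrite gerBl invr_ge0 exprn_ge0.
elim: m => [|m IH]; first by rewrite big_ord0 expr0 invr1 subrr.
by rewrite big_ord_recr /= IH exprS; field.
Qed.

(** Each covering set is thickened slightly so that compactness leaves finitely many, which then
    contain all boxes of one deep level. Counting those boxes with [count_desc] gives 1 <= 4 c0
    (cost + sg), where sg bounds the total price of thickening. *)
Lemma cantor_content (A : set V) : branch_limit `<=` A ->
  exists2 c : R, 0 < c & (c%:E <= hausdorff_content s 1 A)%E.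
Proof.
move=> KA; pose c0 := kap * l 0 `^ (- s).
have c0_gt0 : 0 < c0 by rewrite mulr_gt0 ?powR_gt0// (lt_le_trans _ kap_ge1).
exists (8 * c0)^-1; first by rewrite invr_gt0 mulr_gt0.
apply: le_ereal_inf_tmp => _ [U [AU dU] <-].
(* With this value 1/(4 c0) = 2 sg, so that sg remains for the cover itself. The radius [dl a] is
   chosen to make (2 dl a)^s = sg 2^(-a-1), summable to at most sg. *)
pose sg := (8 * c0)^-1; have sg0 : 0 < sg by rewrite invr_gt0 mulr_gt0.
pose dl (a : nat) := (sg * 2 ^- a.+1) `^ s^-1 / 2.
have pw0 (a : nat) : 0 < sg * 2 ^- a.+1 by rewrite mulr_gt0// invr_gt0 exprn_gt0.
have dl0 a : 0 < dl a by rewrite divr_gt0 ?powR_gt0.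
have dlE a : (2 * dl a) `^ s = sg * 2 ^- a.+1.
  rewrite /dl mulrC divfK ?pnatr_eq0// -powRrM mulVf ?gt_eqF// powRr1//.
  exact: ltW.
have dl_anti a b : (a <= b)%N -> dl b <= dl a.
  move=> ab; rewrite ler_pM2r ?invr_gt0//.
  apply: ge0_ler_powR; rewrite ?nnegrE ?invr_ge0 ?(ltW s_gt0) ?(ltW (pw0 _))//.
  by rewrite ler_pM2l// lef_pV2 ?posrE ?exprn_gt0// ler_weXn2l// ler1n.
pose W a := [set y | exists2 x, U a x & `|x - y| <= dl a].
have [i [I HI]] : eventually_in W 0 root.
  apply: eventually_in_root => x /KA/AU[a _ Ux]; exists a, (dl a); split => //.
  by move=> y xy; exists x.
(* The level is deep enough for l_k to be below the size of every thickened set of index at most I,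
   as [count_desc] requires. *)
have [J HJ] := l_small (mulr_gt0 (ltr0n R 2) (dl0 I)).
pose k := (i + J)%N.
have HK w : w \in desc 0 k root -> exists2 a, (a <= I)%N & box k w `<=` W a.
  by move=> wk; exact: (eventually_deepen ok_root HI wk).
have lk : l k <= 2 * dl I by apply: HJ; exact: leq_addl.
pose d a := fine (diam (U a)).
have dP a : [/\ 0 <= d a, diam (U a) = (d a)%:E &
    forall x y, U a x -> U a y -> `|x - y| <= d a].
  by have [t [/andP[t0 _] e H]] := diam_fin (dU a); rewrite /d e.
pose p a := fine (diam_pow s (U a)).
have pE a : diam_pow s (U a) = (p a)%:E.
  rewrite /p /diam_pow; case: ifP => // _; have [_ -> _] := dP a.
  by rewrite poweR_EFin.
have countW a : (a <= I)%N -> (count (meets (W a) k) (desc 0 k root))%:R <=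
    N k * (c0 * (4 * (p a + sg * 2 ^- a.+1))).
  move=> aI; have p_ge0 : 0 <= p a by rewrite -lee_fin -pE diam_pow_ge0.
  have N0 : 0 <= N k by exact: le_trans (N_ge1 k).
  have [U0|Une] := pselect (U a = set0).
    rewrite (_ : count _ _ = 0%N).
      rewrite mulr_ge0// mulr_ge0 ?(ltW c0_gt0)// mulr_ge0// addr_ge0//.
      exact: ltW.
    apply/eqP; rewrite -leqn0 leqNgt -has_count; apply/hasPn => w _.
    by apply/asboolPn => -[x [_ [y]]]; rewrite U0.
  have Une' : U a !=set0 by apply/set0P/eqP.
  have [da0 daE dist] := dP a.
  have pa : p a = d a `^ s by rewrite /p (diam_pow_EFin _ Une' daE).
  have rho0 : 0 < d a + 2 * dl a by rewrite ltr_wpDl// mulr_gt0.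
  apply: le_trans (@count_desc 0 k root (W a) (d a + 2 * dl a) ok_root rho0 _ _) _.
  - move=> x y [x' Ux xx'] [y' Uy yy'].
    apply: le_trans (ler_distD x' _ _) _; rewrite (distrC x x').
    apply: le_trans (lerD xx' (ler_distD y' _ _)) _.
    have := dist _ _ Ux Uy; lra.
  - apply: (le_trans lk); rewrite ler_wpDl// ler_pM2l//; exact: dl_anti.
  rewrite add0n ler_wpM2l// -/c0 ler_wpM2l ?(ltW c0_gt0)// pa -dlE.
  set t := d a; set u := 2 * dl a; have u0 : 0 <= u by rewrite mulr_ge0// ltW.
  have max0 : 0 <= Num.max t u by rewrite le_max da0.
  apply: (@le_trans _ _ ((2 * Num.max t u) `^ s)).
    apply: ge0_ler_powR; rewrite ?nnegrE ?(ltW s_gt0) ?(ltW rho0) ?mulr_ge0//.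
    have : t <= Num.max t u by rewrite le_max lexx.
    have : u <= Num.max t u by rewrite le_max lexx orbT.
    lra.
  rewrite powRM//; apply: ler_pM; rewrite ?powR_ge0//.
    have -> : 4 = 2 `^ 2 :> R by rewrite powR_mulrn// -natrX.
    by rewrite ler_powR// ler1n.
  rewrite maxEle; case: ifP => _; first by rewrite lerDr powR_ge0.
  by rewrite lerDl powR_ge0.
have sizeN : (size (desc 0 k root))%:R = N k.
  by have := size_desc k ok_root; rewrite /N big_geq// mulr1.
have : N k <= \sum_(a < I.+1) (count (meets (W a) k) (desc 0 k root))%:R.
  rewrite -sizeN -natr_sum ler_nat -sum1_size.
  under [leqRHS]eq_bigr => a _ do rewrite -sum1_count big_mkcond.
  rewrite exchange_big /= big_seq [leqRHS]big_seq; apply: leq_sum => w wk.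
  have [a aI bw] := HK w wk.
  rewrite (bigD1 (Ordinal (aI : (a < I.+1)%N)))//=.
  suff -> : meets (W a) k w by [].
  have [x bx] := box_neq0 (ok_desc ok_root wk); apply/asboolP; exists x.
  by split=> //; exact: bw.
have le_sum : \sum_(a < I.+1) (count (meets (W a) k) (desc 0 k root))%:R <=
    \sum_(a < I.+1) N k * (c0 * (4 * (p a + sg * 2 ^- a.+1))).
  by apply: ler_sum => -[a aI] _; exact: countW.
move=> /le_trans/(_ le_sum); rewrite -mulr_sumr.
rewrite -[X in X <= _]mulr1 ler_pM2l ?(lt_le_trans _ (N_ge1 k))//.
rewrite -!mulr_sumr big_split /= -mulr_sumr => H.
apply: (@le_trans _ _ (\sum_(0 <= a < I.+1) diam_pow s (U a))%E); last first.
  by apply: nneseries_lim_ge => a _ _; exact: diam_pow_ge0.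
rewrite (eq_bigr _ (fun a _ => pE a)) sumEFin lee_fin big_mkord -/sg.
have Sh : sg * (\sum_(a < I.+1) 2 ^- a.+1) <= sg * 1.
  by rewrite ler_pM2l// sum_halves.
set P := \sum_(i0 < I.+1) p i0 in H *.
have : (4 * c0)^-1 <= P + sg.
  rewrite -[leLHS]mul1r ler_pdivrMr; last exact: mulr_gt0.
  apply: (le_trans H); rewrite [leRHS](_ : _ = c0 * (4 * (P + sg))); last by ring.
  by rewrite ler_pM2l// ler_pM2l// lerD2l -[leRHS]mulr1.
have e4 : (4 * c0)^-1 = 2 * sg by rewrite /sg; field; rewrite gt_eqF.
by rewrite e4; lra.
Qed.

End Cantor.

                    

(** * Coordinates in the plane, infinite sets, power sums *)

Section Plane.
Context {R : realType}.
Implicit Types (x y : 'rV[R]_2) (e : R).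

Lemma ord2_ind (P : 'I_2 -> Prop) : P 0 -> P 1 -> forall i, P i.
Proof.
move=> P0 P1 [[|[|//]] i2].
  by rewrite (_ : Ordinal i2 = 0)//; exact: val_inj.
by rewrite (_ : Ordinal i2 = 1)//; exact: val_inj.
Qed.

Lemma coord_le_norm x y i : `|x 0 i - y 0 i| <= `|x - y|.
Proof.
rewrite [leRHS]/Num.Def.normr/= mx_normrE.
by apply: le_trans (le_bigmax _ _ (0, i)); rewrite !mxE.
Qed.

Lemma norm_le_coord x y e : 0 <= e ->
  `|x 0 0 - y 0 0| <= e -> `|x 0 1 - y 0 1| <= e -> `|x - y| <= e.
Proof.
move=> e0 h0 h1; rewrite [leLHS]/Num.Def.normr/= mx_normrE.
apply: bigmax_le => // -[i j] _ /=; rewrite (ord1 i) !mxE.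
exact: (@ord2_ind (fun j => `|x 0 j - y 0 j| <= e)).
Qed.

Lemma max_dist_intP x (q : nat) e :
  \big[Num.max/0]_(i < 2) dist_int (q%:R * x 0 i) < e <->
  exists P1 P2 : int, `|q%:R * x 0 0 - P1%:~R| < e /\
                      `|q%:R * x 0 1 - P2%:~R| < e.
Proof.
split=> [H|[P1 [P2 [H1 H2]]]].
  have [P1 e1] := dist_int_attained (q%:R * x 0 0).
  have [P2 e2] := dist_int_attained (q%:R * x 0 1).
  by exists P1, P2; rewrite -e1 -e2; split; apply: le_lt_trans H;
    exact: (le_bigmax _ (fun i => dist_int (q%:R * x 0 i))).
have dist_le (y : R) (P : int) : `|y - P%:~R| < e -> dist_int y < e.
  apply: le_lt_trans; apply: ge_inf; last by exists P.
  by exists 0 => _ [k _ <-].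
apply: bigmax_lt; first exact: le_lt_trans H1.
by move=> i _; move: i; apply: ord2_ind; [exact: dist_le H1|exact: dist_le H2].
Qed.

Lemma infinite_setP (A : set nat) :
  infinite_set A <-> forall n, exists2 q, (n <= q)%N & A q.
Proof.
split=> [iA n|H fA].
  apply: contrapT => nA; apply: iA; apply: (@sub_finite_set _ _ `I_n); last first.
    exact: finite_II.
  by move=> q Aq /=; rewrite ltnNge; apply/negP => nq; apply: nA; exists q.
have /finite_seqP[r rA] := fA.
have [q rq] := H (\max_(i <- r) i).+1; rewrite rA /= => qr.
by have := @leq_bigmax_seq _ r xpredT id q qr isT; rewrite leqNgt rq.
Qed.

End Plane.

Section PowerSums.
Context {R : realType}.

Lemma powR_small (delta e : R) : 0 < delta -> 0 < e ->
  exists N, forall n, (N <= n)%N -> n%:R `^ (- delta) <= e.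
Proof.
move=> d0 e0; pose y := (e^-1) `^ delta^-1.
exists (Num.truncn y).+1 => n Nn.
have yn : y <= n%:R.
  apply/ltW/(lt_le_trans (truncnS_gt y)); by rewrite ler_nat.
have y0 : 0 < y by rewrite powR_gt0 ?invr_gt0.
have n0 : 0 < n%:R :> R by exact: lt_le_trans yn.
rewrite powRN invf_ple ?posrE ?powR_gt0//.
have -> : e^-1 = y `^ delta.
  by rewrite /y -powRrM mulVf ?gt_eqF// powRr1// invr_ge0 ltW.
by rewrite ge0_ler_powR ?nnegrE ?(ltW d0) ?(ltW y0).
Qed.

(** With Q = q+1 this is (1 - 1/Q)^(-delta) >= 1 + delta/Q multiplied by Q^(-delta); the inequality
    follows from exp(x) >= 1 + x and ln(1 + x) <= x. *)
Lemma powR_telescope (delta : R) (q : nat) : 0 < delta -> (0 < q)%N ->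
  delta * q.+1%:R `^ (- (1 + delta)) <=
    q%:R `^ (- delta) - q.+1%:R `^ (- delta).
Proof.
move=> d0 q0; have q0' : 0 < q%:R :> R by rewrite ltr0n.
set Q : R := q.+1%:R; have Q0 : 0 < Q by rewrite ltr0n.
have qE : q%:R = Q * (1 - Q^-1).
  by rewrite mulrBr mulfV ?gt_eqF// mulr1 /Q -natr1 addrK.
have u0 : 0 < 1 - Q^-1 by rewrite -(pmulr_rgt0 _ Q0) -qE.
have QE : Q `^ (- (1 + delta)) = Q^-1 * Q `^ (- delta).
  rewrite opprD powRD; last by apply/implyP => _; rewrite gt_eqF.
  by rewrite powR_inv1// ltW.
have BE : 1 + delta * Q^-1 <= (1 - Q^-1) `^ (- delta).
  rewrite /powR gt_eqF//; apply: le_trans (expR_ge1Dx _).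
  rewrite lerD2l mulNr -mulrN ler_wpM2l ?(ltW d0)// lerNr.
  by apply: le_ln1Dx; rewrite ltrN2 -subr_gt0.
rewrite QE {1}qE powRM ?(ltW Q0) ?(ltW u0)//.
have := ler_wpM2l (powR_ge0 Q (- delta)) BE.
set a := Q `^ _; set b := (1 - _) `^ _; set c := Q^-1; lra.
Qed.

Lemma powR_sum_le (delta : R) (N n : nat) : 0 < delta -> (0 < N)%N ->
  \sum_(N.+1 <= q < n) q%:R `^ (- (1 + delta)) <= delta^-1 * N%:R `^ (- delta).
Proof.
move=> d0 N0; have [nN|Nn] := leqP n N.+1.
  by rewrite big_geq// mulr_ge0 ?powR_ge0// invr_ge0 ltW.
rewrite ler_pdivlMl// mulr_sumr.
suff H k : \sum_(N.+1 <= q < N.+1 + k) delta * q%:R `^ (- (1 + delta)) <=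
    N%:R `^ (- delta) - (N + k)%:R `^ (- delta).
  rewrite -(subnKC (ltnW Nn)); apply: (le_trans (H _)).
  by rewrite gerBl powR_ge0.
elim: k => [|k IH]; first by rewrite addn0 big_geq// addn0 subrr.
rewrite addnS big_nat_recr ?leq_addr//=; apply: le_trans (lerD IH (lexx _)) _.
rewrite addSn addnS -lerBrDl; apply: le_trans (powR_telescope d0 _) _.
  by rewrite addn_gt0 N0.
lra.
Qed.

End PowerSums.

(** * Upper bound: covering by squares around rationals *)

Section UpperBound.
Context {R : realType}.
Variables (psi : nat -> R) (tau s : R) (q0 : nat).
Hypothesis psi_range : forall q, (0 < q)%N -> 0 <= psi q < 2^-1.
Hypothesis psi_tau : forall q, (q0 <= q)%N -> psi q <= q%:R `^ (- tau).
Hypotheses (s_gt0 : 0 < s) (tau_s : 3 < s * (tau + 1)) (tau1 : -1 < tau).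

Definition square (t : nat * (nat * nat)) : set 'rV[R]_2 :=
  [set x | `|x 0 0 - t.2.1%:R / t.1%:R| <= psi t.1 / t.1%:R /\
           `|x 0 1 - t.2.2%:R / t.1%:R| <= psi t.1 / t.1%:R].

Let admissible N (t : nat * (nat * nat)) :=
  [&& (N < t.1)%N, (t.2.1 <= t.1)%N & (t.2.2 <= t.1)%N].

(** The squares with denominator above N and numerators in [0,q], listed by the codes of the
    triples; codes of nothing relevant give the empty set, which costs 0. *)
Definition square_cover (N i : nat) : set 'rV[R]_2 :=
  if pickle_inv i is Some t then if admissible N t then square t else set0
  else set0.

Lemma square_cover_covers N :
  well_approximable 2 psi `<=` \bigcup_i square_cover N i.
Proof.
move=> x [x01 /infinite_setP/(_ N.+1)[q Nq [q1 /max_dist_intP[P1 [P2 [h1 h2]]]]]].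
have q1' : 0 < q%:R :> R by rewrite ltr0n.
have /andP[_ p2] := psi_range q1.
(* Because psi(q) < 1/2 and q x_i lies in [0,q], the integer P lies strictly between -1 and q +
   1. *)
have natP i (P : int) : `|q%:R * x 0 i - P%:~R| < psi q ->
    exists2 p : nat, P = p%:Z & (p <= q)%N.
  have /andP[xi0 xi1] := x01 i.
  have y0 : 0 <= q%:R * x 0 i by rewrite mulr_ge0// ltW.
  have y1 : q%:R * x 0 i <= q%:R by rewrite ler_piMr// ltW.
  rewrite ltr_norml => /andP[a b].
  have : (-1)%:~R < P%:~R :> R by rewrite rmorphN /=; lra.
  rewrite ltr_int; case: P a b => [p|//] a b _; exists p => //.
  rewrite -ltnS -(ltr_nat R) -natr1; move: a b; rewrite -!pmulrn; lra.
have [p1 e1 p1q] := natP _ _ h1; have [p2' e2 p2q] := natP _ _ h2.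
exists (pickle (q, (p1, p2'))) => //; rewrite /square_cover pickleK_inv.
rewrite /admissible /= Nq p1q p2q /=.
have aux i (p : nat) : `|q%:R * x 0 i - p%:Z%:~R| < psi q ->
    `|x 0 i - p%:R / q%:R| <= psi q / q%:R.
  move=> /ltW; rewrite -pmulrn => H; rewrite ler_pdivlMr//.
  rewrite -[X in _ * X](gtr0_norm q1') -normrM mulrBl divfK ?gt_eqF//.
  by rewrite mulrC.
by split; [apply: aux; rewrite -e1|apply: aux; rewrite -e2].
Qed.

Lemma diam_pow_square t : (0 < t.1)%N -> (q0 <= t.1)%N ->
  (diam_pow s (square t) <= (2 `^ s * t.1%:R `^ (- (s * (tau + 1))))%:E)%E.
Proof.
move=> t0 qt; have t0' : 0 < t.1%:R :> R by rewrite ltr0n.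
have psi0 : 0 <= psi t.1 by have /andP[] := psi_range t0.
have d0 : 0 <= 2 * (psi t.1 / t.1%:R) by rewrite mulr_ge0// divr_ge0.
apply: le_trans (diam_pow_le (ltW s_gt0) d0 _) _.
  move=> x y [x1 x2] [y1 y2]; apply: norm_le_coord => //.
    apply: le_trans (ler_distD (t.2.1%:R / t.1%:R) _ _) _.
    by rewrite (distrC _ (y 0 0)); lra.
  apply: le_trans (ler_distD (t.2.2%:R / t.1%:R) _ _) _.
  by rewrite (distrC _ (y 0 1)); lra.
rewrite lee_fin powRM ?divr_ge0// ler_wpM2l ?powR_ge0//.
have -> : t.1%:R `^ (- (s * (tau + 1))) = (t.1%:R `^ (- tau) / t.1%:R) `^ s :> R.
  rewrite -[X in _ / X]powRr1 ?(ltW t0')// -powRN -powRD.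
    by rewrite -powRrM; congr (_ `^ _); ring.
  by apply/implyP => _; rewrite gt_eqF.
rewrite ge0_ler_powR ?nnegrE ?(ltW s_gt0) ?divr_ge0 ?powR_ge0//.
by rewrite ler_pM2r ?invr_gt0// psi_tau.
Qed.

(** There are at most (q+1)^2 <= 4q^2 squares of denominator q, so the sum is dominated by a tail of
    the sum of q^(2 - s(tau+1)). *)
Lemma square_cover_sum N n : (0 < N)%N -> (q0 <= N)%N ->
  (\sum_(0 <= i < n) diam_pow s (square_cover N i) <=
   (4 * 2 `^ s * ((s * (tau + 1) - 3)^-1 * N%:R `^ (- (s * (tau + 1) - 3))))%:E)%E.
Proof.
move=> N0 qN; set delta := s * (tau + 1) - 3.
have delta0 : 0 < delta by rewrite subr_gt0.
pose L := [seq t <- pmap pickle_inv (iota 0 n) | admissible N t].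
have uL : uniq L by apply/filter_uniq/(pmap_uniq (@pickle_invK _))/iota_uniq.
pose c (q : nat) : R := 2 `^ s * q%:R `^ (- (s * (tau + 1))).
have c0 q : 0 <= c q by rewrite mulr_ge0 ?powR_ge0.
apply: (@le_trans _ _ (\sum_(t <- L) c t.1)%:E).
  rewrite -sumEFin big_filter [leRHS]big_mkcond big_pmap /index_iota subn0.
  apply: lee_sum => i _; rewrite /square_cover.
  have d00 : diam_pow s (set0 : set 'rV[R]_2) = 0%E by rewrite /diam_pow eqxx.
  case: pickle_inv => [t|] /=; last by rewrite d00.
  case: ifPn => [/and3P[Nt _ _]|_]; last by rewrite d00.
  apply: diam_pow_square; first exact: leq_trans Nt.
  by rewrite (leq_trans qN)// ltnW.
rewrite lee_fin.
pose B := (\max_(t <- L) t.1).+1.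
pose c' (q : nat) := if (N < q)%N then c q else 0.
pose b (q : nat) : R := (q.+1%:R) ^+ 2.
have := @sum_by_key R _ L (fun t => t.1) B c' b (fun t => c t.1).
move=> /(_ _ _ _)/le_trans; apply.
- move=> t tL; rewrite ltnS (@leq_bigmax_seq _ L xpredT (fun t => t.1) t tL isT).
  by move: tL; rewrite mem_filter /c' => /andP[/and3P[-> _ _] _].
- by move=> j _; rewrite /c'; case: ifP.
- move=> j _; rewrite /b -natrX ler_nat.
  have -> : (j.+1 ^ 2 = size [seq (j, (x, y)) | x <- iota 0 j.+1, y <- iota 0 j.+1])%N.
    by rewrite size_allpairs !size_iota.
  apply: uniq_leq_size; first exact: filter_uniq.
  move=> [q [x y]] H.
  have [-> h1 h2] : [/\ q = j, (x <= j)%N & (y <= j)%N].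
    by move: H; rewrite !mem_filter => /andP[/eqP <- /andP[/and3P[]]].
  by apply/allpairsP; exists (x, y); rewrite !mem_iota !ltnS.
rewrite -(big_mkord xpredT (fun j => b j * c' j)).
apply: (@le_trans _ _ (\sum_(N.+1 <= q < B) 4 * 2 `^ s * q%:R `^ (- (1 + delta)))).
  have [BN|NB] := leqP B N.+1.
    rewrite [leRHS]big_geq// big_nat big1// => j /andP[_ jB].
    by rewrite /c' ltnNge -ltnS (leq_trans jB BN) mulr0.
  rewrite (big_cat_nat (n := N.+1)) ?(ltnW NB)//= big_nat big1 ?add0r; last first.
    by move=> j /andP[_ jB]; rewrite /c' ltnNge -ltnS jB mulr0.
  rewrite big_nat [leRHS]big_nat; apply: ler_sum => q /andP[Nq _].
  rewrite /c' Nq /b /c.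
  have q1 : 1 <= q%:R :> R by rewrite ler1n (leq_trans _ Nq).
  have q0' : 0 < q%:R :> R by lra.
  have -> : 4 * 2 `^ s * q%:R `^ (- (1 + delta)) =
      (4 * q%:R ^+ 2) * (2 `^ s * q%:R `^ (- (s * (tau + 1)))) :> R.
    have -> : - (1 + delta) = 2 + - (s * (tau + 1)) by rewrite /delta; ring.
    rewrite powRD; last by apply/implyP => _; rewrite gt_eqF.
    by rewrite powR_mulrn ?(ltW q0')//; ring.
  rewrite ler_wpM2r ?c0// -(natr1 q).
  have := sqr_ge0 (q%:R - 1 : R); rewrite !expr2; nra.
rewrite -mulr_sumr ler_wpM2l ?mulr_ge0 ?powR_ge0//.
exact: powR_sum_le.
Qed.

Lemma hausdorff_measure_well_approximable :
  hausdorff_measure s (well_approximable 2 psi) = 0%E.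
Proof.
pose delta := s * (tau + 1) - 3.
have delta0 : 0 < delta by rewrite subr_gt0.
have content0 d : 0 < d -> hausdorff_content s d (well_approximable 2 psi) = 0%E.
  move=> d0; apply/eqP; rewrite eq_le; apply/andP; split; last first.
    apply: le_ereal_inf_tmp => _ [U _ <-].
    by apply: nneseries_ge0 => i _ _; exact: diam_pow_ge0.
  apply/lee_addgt0Pr => e e0; rewrite add0e.
  have tau10 : 0 < tau + 1 by rewrite -ltrBlDr sub0r.
  have d20 : 0 < d / 2 by rewrite divr_gt0.
  have [N1 HN1] := powR_small tau10 d20.
  pose K := 4 * 2 `^ s * delta^-1.
  have K0 : 0 < K by rewrite mulr_gt0 ?mulr_gt0 ?powR_gt0// invr_gt0.
  have [N2 HN2] := powR_small delta0 (divr_gt0 e0 K0).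
  pose N := (N1 + N2 + q0).+1.
  apply: ge_ereal_inf; exists (\sum_(0 <= i <oo) diam_pow s (square_cover N i))%E.
    exists (square_cover N) => //; split; first exact: square_cover_covers.
    move=> i; rewrite /square_cover.
    have dset0 : (diam (set0 : set 'rV[R]_2) <= d%:E)%E.
      by apply: diam_le => //; exact: ltW.
    case: pickle_inv => [t|//]; case: ifP => // /and3P[Nt _ _].
    have t0 : (0 < t.1)%N by exact: leq_trans Nt.
    have t0' : 0 < t.1%:R :> R by rewrite ltr0n.
    have psi0 : 0 <= psi t.1 by have /andP[] := psi_range t0.
    have small : psi t.1 / t.1%:R <= d / 2.
      apply: le_trans (HN1 t.1 _); last first.
        by apply: leq_trans (ltnW Nt); rewrite /N -addnA -addnS leq_addr.
      rewrite opprD powRD; last by apply/implyP => _; rewrite gt_eqF.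
      rewrite powR_inv1 ?(ltW t0')// ler_pM2r ?invr_gt0// psi_tau//.
      by apply: leq_trans (ltnW Nt); rewrite /N -addnS; lia.
    apply: diam_le => [|x y [x1 x2] [y1 y2]]; first exact: ltW.
    apply: norm_le_coord; first exact: ltW.
      apply: le_trans (ler_distD (t.2.1%:R / t.1%:R) _ _) _.
      by rewrite (distrC _ (y 0 0)); lra.
    apply: le_trans (ler_distD (t.2.2%:R / t.1%:R) _ _) _.
    by rewrite (distrC _ (y 0 1)); lra.
  apply: lime_le; first by apply: is_cvg_nneseries => i _ _; exact: diam_pow_ge0.
  apply: nearW => n; apply: le_trans (square_cover_sum _ _ _) _ => //.
    by rewrite /N; lia.
  rewrite lee_fin mulrA -/K mulrC -ler_pdivlMr//; apply: HN2.
  by rewrite /N; lia.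
apply/eqP; rewrite eq_le; apply/andP; split.
  by apply: ge_ereal_sup => _ [d d0 <-]; rewrite content0.
by apply: ereal_sup_ubound; exists 1 => //=; rewrite content0.
Qed.

End UpperBound.

                           

(** * Comparison of psi with powers of q *)

Section Order.
Context {R : realType}.
Variables (psi : nat -> R) (lambda : \bar R).
Hypothesis psi_range : forall q : nat, (0 < q)%N -> 0 <= psi q < 2^-1.
Hypothesis qpsi_noninc : forall p q : nat, (0 < p)%N -> (p <= q)%N ->
  q%:R * psi q <= p%:R * psi p.
Hypothesis qpsi_to0 : (fun q : nat => q%:R * psi q) @ \oo --> (0 : R).
Hypothesis psi_order :
  (fun q : nat => (- lne (psi q)%:E / (ln q%:R)%:E)%E) @ \oo --> lambda.

Lemma qpsi_small e : 0 < e -> exists N, forall q, (N <= q)%N ->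
  q%:R * psi q <= e.
Proof.
move=> e0; move/cvgr0Pnorm_le: qpsi_to0 => /(_ e e0) [N _ HN].
by exists N => q Nq; apply: le_trans (HN q Nq); exact: ler_norm.
Qed.

Lemma order_eventually (A : set (\bar R)) : open A -> A lambda ->
  exists N, forall q, (N <= q)%N ->
    A (- lne (psi q)%:E / (ln q%:R)%:E)%E.
Proof.
move=> oA Al.
have [N _ HN] := psi_order (open_nbhs_nbhs (conj oA Al)).
by exists N => q Nq; exact: HN.
Qed.

Lemma order_pos q : (1 < q)%N -> 0 < psi q ->
  (- lne (psi q)%:E / (ln q%:R)%:E)%E = (- ln (psi q) / ln q%:R)%:E.
Proof.
move=> q1 p0; have lq : 0 < ln q%:R :> R by rewrite ln_gt0// ltr1n.
by rewrite /= leNgt p0 /= inver gt_eqF.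
Qed.

Lemma order_zero q : (1 < q)%N -> psi q = 0 ->
  (- lne (psi q)%:E / (ln q%:R)%:E)%E = +oo%E.
Proof.
move=> q1 ->; have lq : 0 < ln q%:R :> R by rewrite ln_gt0// ltr1n.
by rewrite /= lexx /= inver gt_eqF// gt0_mulye// lte_fin invr_gt0.
Qed.

Lemma psi_le_powR tau : (tau%:E < lambda)%E -> exists N, forall q, (N <= q)%N ->
  psi q <= q%:R `^ (- tau).
Proof.
move=> /(order_eventually (@open_ereal_gt_ereal R _))[N HN].
exists (maxn N 2) => q; rewrite geq_max => /andP[Nq q2].
have q0 : 0 < q%:R :> R by rewrite ltr0n (leq_trans _ q2).
have lq : 0 < ln q%:R :> R by rewrite ln_gt0// ltr1n.
have [p0|p0] := ltP 0 (psi q); last by rewrite (le_trans p0)// powR_ge0.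
have := HN q Nq; rewrite /mkset order_pos// lte_fin ltr_pdivlMr// => H.
rewrite -ler_ln ?posrE ?powR_gt0// ln_powR mulNr lerNr.
exact: ltW.
Qed.

Lemma psi_ge_powR theta : (lambda < theta%:E)%E -> exists N, forall q,
  (N <= q)%N -> q%:R `^ (- theta) <= psi q.
Proof.
move=> /(order_eventually (@open_ereal_lt_ereal R _))[N HN].
exists (maxn N 2) => q; rewrite geq_max => /andP[Nq q2].
have q0 : 0 < q%:R :> R by rewrite ltr0n (leq_trans _ q2).
have lq : 0 < ln q%:R :> R by rewrite ln_gt0// ltr1n.
have /andP[p0 _] := psi_range (ltnW q2).
have [p00|pn0] := eqVneq (psi q) 0.
  by have := HN q Nq; rewrite /mkset order_zero.
have {pn0}p0 : 0 < psi q by rewrite lt_neqAle eq_sym pn0.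
have := HN q Nq; rewrite /mkset order_pos// lte_fin ltr_pdivrMr// => H.
rewrite -ler_ln ?posrE ?powR_gt0// ln_powR mulNr lerNl.
exact: ltW.
Qed.

Lemma order_ge1 : (1 <= lambda)%E.
Proof.
rewrite leNgt; apply/negP => /(order_eventually (@open_ereal_lt_ereal R _))[N HN].
have [M HM] := qpsi_small ltr01.
pose q := (maxn N (maxn M 2)).
have [Nq Mq q2] : [/\ (N <= q)%N, (M <= q)%N & (2 <= q)%N].
  by rewrite /q; split; lia.
have q0 : 0 < q%:R :> R by rewrite ltr0n (leq_trans _ q2).
have lq : 0 < ln q%:R :> R by rewrite ln_gt0// ltr1n.
have /andP[p0 _] := psi_range (ltnW q2).
have := HN q Nq; rewrite /mkset.
have [p00|pn0] := eqVneq (psi q) 0; first by rewrite order_zero.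
have {pn0}p0 : 0 < psi q by rewrite lt_neqAle eq_sym pn0.
rewrite order_pos// lte_fin ltr_pdivrMr// mul1r ltNge => /negP; apply.
rewrite lerNr -lnV ?posrE// ler_ln ?posrE ?invr_gt0//.
by rewrite -[leRHS]mul1r ler_pdivlMr// mulrC HM.
Qed.

(** A zero of psi would propagate to all larger q by monotonicity of q psi(q), whereas a finite
    order keeps psi above some power q^(-theta) for large q. *)
Lemma psi_gt0 : (lambda < +oo)%E -> forall q, (0 < q)%N -> 0 < psi q.
Proof.
move=> lfin q q0; have /andP[p0 _] := psi_range q0.
rewrite lt_neqAle p0 andbT eq_sym; apply/eqP => pq0.
have [theta Hth] : exists theta : R, (lambda < theta%:E)%E.
  have := order_ge1; case: lambda lfin => [l _ _|//|//].
  by exists (l + 1); rewrite lte_fin ltrDl.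
have [N HN] := psi_ge_powR Hth.
pose Q := maxn N q; have qQ : (q <= Q)%N by rewrite leq_maxr.
have Q0 : 0 < Q%:R :> R by rewrite ltr0n (leq_trans q0).
have := qpsi_noninc q0 qQ; rewrite pq0 mulr0 leNgt => /negP; apply.
rewrite mulr_gt0//; apply: lt_le_trans (HN Q (leq_maxl _ _)).
exact: powR_gt0.
Qed.

End Order.

                                       

(** * Choice of the scales of the Cantor set *)

Lemma exists_above (a b c d e f : nat) : exists m : nat,
  [/\ (a < m)%N, (b <= m)%N, (c <= m)%N & [/\ (d <= m)%N, (e <= m)%N & (f <= m)%N]].
Proof. by exists (a.+1 + b + c + d + e + f)%N; split; [..|split]; lia. Qed.

Section Construction.
Context {R : realType}.
Variables (psi : nat -> R) (C : nat) (s theta : R).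
Hypothesis psi_gt0 : forall q, (0 < q)%N -> 0 < psi q.
Hypothesis qpsi_small : forall e : R, 0 < e -> exists N, forall q, (N <= q)%N ->
  q%:R * psi q <= e.
Hypothesis psi_theta : exists N, forall q, (N <= q)%N ->
  q%:R `^ (- theta) <= psi q.
Hypothesis C_ge : 48 ^+ 2 <= C%:R :> R.
Hypotheses (s_gt0 : 0 < s) (s_theta : s * (theta + 1) < 3).

Let node := ((int * int) * nat)%type.

Definition eta (k : nat) : R := k.+2%:R^-1.

Definition mesh (m : nat) : R := 4 * C%:R / m%:R ^+ 3.

(** Smallest possible side of a box at level k when denominators are at most m^2; it makes all
    estimates uniform over a level. *)
Definition min_side (k m : nat) : R := eta k * (psi (m ^ 2) / (m ^ 2)%:R) / 2.

Definition nb_children (k m m' : nat) : nat :=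
  Num.truncn ((min_side k m / mesh m') ^+ 2 / 8).

                                                                                 
(** What m' must satisfy to follow m: the hypotheses of [exists_children], smallness of q psi(q) for
    the children, C m^2 <= m'^2 so that denominators increase strictly, and the mass condition of
    the Cantor estimate. *)
Definition next_scale (k m m' : nat) : Prop :=
  [/\ (0 < m')%N /\ 224 * C%:R <= m'%:R * min_side k m, (C <= m')%N,
      forall Q, (m' ^ 2 <= C * Q)%N ->
        55 ^+ 2 * C%:R * (Q%:R * psi Q) <= eta k.+1,
      (C * m ^ 2 <= m' ^ 2)%N &
      1 <= (nb_children k m m')%:R * min_side k.+1 m' `^ s].

Let C0 : 0 < C%:R :> R.
Proof. by apply: lt_le_trans C_ge; rewrite exprn_gt0. Qed.

Lemma eta_gt0 k : 0 < eta k. Proof. by rewrite invr_gt0 ltr0n. Qed.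

Lemma eta_le_half k : eta k <= 2^-1.
Proof. by rewrite lef_pV2 ?posrE ?ltr0n// ler_nat. Qed.

Lemma mesh_gt0 m : (0 < m)%N -> 0 < mesh m.
Proof. by move=> m0; rewrite divr_gt0 ?exprn_gt0 ?ltr0n// mulr_gt0. Qed.

Lemma min_side_gt0 k m : (0 < m)%N -> 0 < min_side k m.
Proof.
move=> m0; have m2 : (0 < m ^ 2)%N by rewrite expn_gt0 m0.
by rewrite divr_gt0// mulr_gt0 ?eta_gt0// divr_gt0 ?psi_gt0// ltr0n.
Qed.

Lemma min_side_mesh k m m' : (0 < m')%N ->
  224 * C%:R <= m'%:R * min_side k m -> 4 * mesh m' <= min_side k m.
Proof.
move=> m'0 H; have m0 : 0 < m'%:R :> R by rewrite ltr0n.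
have m1 : 1 <= m'%:R :> R by rewrite ler1n.
rewrite /mesh [leLHS](_ : _ = 16 * C%:R / m'%:R ^+ 3); last first.
  by field; rewrite gt_eqF.
rewrite ler_pdivrMr ?exprn_gt0//.
have l0 : 0 <= min_side k m.
  rewrite -(ler_pM2l m0) mulr0; apply: le_trans H.
  exact: mulr_ge0 (ler0n _ _) (ler0n _ _).
apply: (@le_trans _ _ (m'%:R * min_side k m)).
  by apply: le_trans H; rewrite ler_pM2r// ler_nat.
by rewrite mulrC ler_wpM2l// ler_eXnr// ler1n.
Qed.

Lemma nb_children_ge k m m' : 4 * mesh m' <= min_side k m -> (0 < m')%N ->
  (min_side k m / mesh m') ^+ 2 / 16 <= (nb_children k m m')%:R.
Proof.
move=> H m'0; have h0 := mesh_gt0 m'0; set y := min_side k m / mesh m'.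
have y4 : 4 <= y by rewrite /y ler_pdivlMr.
have y2 : 16 <= y ^+ 2 by rewrite expr2; nra.
have := truncnS_gt (y ^+ 2 / 8); rewrite -(natr1 (Num.truncn _)).
rewrite -/(nb_children k m m'); lra.
Qed.

(** All conditions hold for m' large. For the mass condition, the number of children grows like m'^6
    while the s-th power of their side decays at worst like m'^(-2 s (theta+1)), and the exponent
    [delta] that remains is positive because s (theta+1) < 3. *)
Lemma next_scale_exists k m : (0 < m)%N -> exists m', next_scale k m m'.
Proof.
move=> m0; set l := min_side k m; have l0 : 0 < l by exact: min_side_gt0.
have e0 : 0 < eta k.+1 / (55 ^+ 2 * C%:R).
  by rewrite divr_gt0 ?eta_gt0// mulr_gt0// exprn_gt0.
have [N1 HN1] := qpsi_small e0.
have [N2 HN2] := psi_theta.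
pose delta := 6 - 2 * (s * (theta + 1)).
have delta0 : 0 < delta by rewrite /delta; move: s_theta; lra.
pose K := l ^+ 2 / (16 * 16 * C%:R ^+ 2) * (eta k.+1 / 2) `^ s.
have K0 : 0 < K.
  rewrite mulr_gt0 ?powR_gt0 ?divr_gt0 ?eta_gt0 ?exprn_gt0//.
  by rewrite mulr_gt0// exprn_gt0.
have [N3 HN3] := powR_small delta0 K0.
pose N4 := (Num.truncn (224 * C%:R / l)).+1.
have [m' [C1m' N2m' N3m' [N4m' Cmm' Cm']]] :=
  exists_above (C * N1) N2 N3 N4 (C * m) C.
have m'0 : (0 < m')%N by exact: leq_ltn_trans C1m'.
have m'0R : 0 < m'%:R :> R by rewrite ltr0n.
have m'sq : (m' <= m' ^ 2)%N by rewrite -mulnn leq_pmulr.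
have H1 : 224 * C%:R <= m'%:R * l.
  rewrite -ler_pdivrMr//; apply/ltW/(lt_le_trans (truncnS_gt _)).
  by rewrite ler_nat.
have h0 := mesh_gt0 m'0.
have H2 : 4 * mesh m' <= l by exact: min_side_mesh.
exists m'; split => //.
- move=> Q HQ; rewrite mulrC -ler_pdivlMr; last by rewrite mulr_gt0// exprn_gt0.
  apply: HN1; rewrite leqNgt; apply/negP => QN.
  have CQ : (C * Q <= C * N1)%N by rewrite leq_mul2l (ltnW QN) orbT.
  by have := leq_trans (leq_trans m'sq HQ) CQ; rewrite leqNgt C1m'.
- have Cpos : (0 < C)%N by rewrite -(ltr0n R).
  apply: leq_trans (_ : (C * m) ^ 2 <= _)%N; last by rewrite leq_exp2r.
  by rewrite expnMn leq_mul2r -{1}(expn1 C) leq_pexp2l ?orbT.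
have m'2 : (N2 <= m' ^ 2)%N by exact: leq_trans m'sq.
have psi_m' := HN2 _ m'2.
have side_ge : eta k.+1 / 2 * m'%:R `^ (- (2 * (theta + 1))) <= min_side k.+1 m'.
  rewrite /min_side [leRHS]mulrAC ler_wpM2l ?divr_ge0 ?(ltW (eta_gt0 _))//.
  have -> : m'%:R `^ (- (2 * (theta + 1))) =
      (m' ^ 2)%:R `^ (- theta) / (m' ^ 2)%:R :> R.
    rewrite natrX -powR_mulrn ?(ltW m'0R)// -powRrM -powRN -powRD.
      by congr (_ `^ _); ring.
    by apply/implyP => _; rewrite gt_eqF.
  by rewrite ler_pM2r// invr_gt0 ltr0n expn_gt0 m'0.
have nc := nb_children_ge H2 m'0.
apply: (@le_trans _ _ ((min_side k m / mesh m') ^+ 2 / 16 *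
   (eta k.+1 / 2 * m'%:R `^ (- (2 * (theta + 1)))) `^ s)); last first.
  apply: ler_pM => //; rewrite ?powR_ge0//.
    by rewrite divr_ge0 ?sqr_ge0.
  apply: ge0_ler_powR; rewrite ?nnegrE ?(ltW s_gt0)//.
    by rewrite mulr_ge0 ?powR_ge0// divr_ge0 ?(ltW (eta_gt0 _)).
  by rewrite ltW// min_side_gt0.
rewrite powRM ?powR_ge0 ?divr_ge0 ?(ltW (eta_gt0 _))// -powRrM.
have -> : (min_side k m / mesh m') ^+ 2 / 16 *
   ((eta k.+1 / 2) `^ s * m'%:R `^ (- (2 * (theta + 1)) * s)) =
   K * m'%:R `^ delta.
  have -> : delta = 6 + - (2 * (theta + 1)) * s by rewrite /delta; ring.
  rewrite powRD; last by apply/implyP => _; rewrite gt_eqF.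
  rewrite powR_mulrn ?(ltW m'0R)// /K -/l /mesh.
  by field; rewrite !gt_eqF.
rewrite -ler_pdivrMr ?powR_gt0// mul1r -powRN; exact: HN3.
Qed.

End Construction.

(** * Nodes, boxes and children of the Cantor set *)

Section Tree.
Context {R : realType}.
Variables (psi : nat -> R) (C : nat) (s : R).
Hypothesis psi_gt0 : forall q, (0 < q)%N -> 0 < psi q.
Hypothesis psi_noninc : forall p q : nat, (0 < p)%N -> (p <= q)%N ->
  q%:R * psi q <= p%:R * psi p.
Hypothesis C_ge : 48 ^+ 2 <= C%:R :> R.

Local Notation eta := (@eta R).
Local Notation mesh := (@mesh R C).
Local Notation node := ((int * int) * nat)%type.

Let C0 : 0 < C%:R :> R.
Proof. by apply: lt_le_trans C_ge; rewrite exprn_gt0. Qed.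

(** The box sits just inside the right edge of the approximation square of v, so its points are
    almost as badly approximated by v as psi allows; the first coordinate alone ensures this. *)
Definition corner1 (k : nat) (v : node) : R :=
  v.1.1%:~R / v.2%:R + (1 - eta k) * (psi v.2 / v.2%:R).

Definition corner2 (v : node) : R := v.1.2%:~R / v.2%:R.

Definition side (k : nat) (v : node) : R := eta k * (psi v.2 / v.2%:R) / 2.

Definition box (k : nat) (v : node) : set 'rV[R]_2 :=
  [set x | corner1 k v <= x 0 0 <= corner1 k v + side k v /\
           corner2 v <= x 0 1 <= corner2 v + side k v].

Definition admissible_node (k m : nat) (v : node) : Prop :=
  [/\ primitive v.1.1 v.1.2 v.2, (0 < v.2 <= m ^ 2)%N, (m ^ 2 <= C * v.2)%N &
      55 ^+ 2 * C%:R * (v.2%:R * psi v.2) <= eta k].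

Definition excludes (k : nat) (v w : node) : Prop :=
  forall (Q : nat) (P : int * int) (x : 'rV[R]_2), (v.2 <= Q < w.2)%N ->
    ~ collinear v.1.1 v.1.2 v.2 P Q -> box k w x ->
    ~ (`|x 0 0 - P.1%:~R / Q%:R| < psi Q / Q%:R /\
       `|x 0 1 - P.2%:~R / Q%:R| < psi Q / Q%:R).

Lemma min_side_le_side k m v : (0 < v.2 <= m ^ 2)%N ->
  min_side psi k m <= side k v.
Proof.
move=> /andP[q0 qm]; rewrite /min_side /side ler_pM2r ?invr_gt0//.
rewrite ler_pM2l ?eta_gt0//; apply: psi_quot_le => //.
by move=> q /psi_gt0/ltW.
Qed.

Lemma box_close k v x : (0 < v.2)%N -> box k v x ->
  `|x 0 0 - v.1.1%:~R / v.2%:R| < psi v.2 / v.2%:R /\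
  `|x 0 1 - v.1.2%:~R / v.2%:R| < psi v.2 / v.2%:R.
Proof.
move=> q0; rewrite /box /corner1 /corner2 /side /=.
have r0 : 0 < psi v.2 / v.2%:R by rewrite divr_gt0 ?psi_gt0// ltr0n.
have e0 := @eta_gt0 R k; have e2 := @eta_le_half R k.
have er0 : 0 < eta k * (psi v.2 / v.2%:R) by rewrite mulr_gt0.
have er1 : eta k * (psi v.2 / v.2%:R) <= (psi v.2 / v.2%:R) / 2.
  by rewrite [leRHS]mulrC ler_pM2r.
move: er0 er1 r0; set z := psi v.2 / v.2%:R.
set u := v.1.1%:~R / _; set w := v.1.2%:~R / _.
rewrite mulrBl mul1r; set y := eta k * z => er0 er1 r0.
move=> [/andP[a1 a2] /andP[a3 a4]].
by rewrite !ltr_norml; split; apply/andP; split; lra.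
Qed.

(** The children given by [exists_children] belong to distinct grid points, and each child box stays
    within 3/8 of the mesh from its grid point. Hence child boxes stay in the parent box and are
    separated like the grid, which yields the count with the constant 48^2. *)
Lemma children_list k m m' v :
  admissible_node k m v -> (0 < m)%N -> next_scale psi C s k m m' ->
  exists L : seq node, [/\ size L = nb_children psi C k m m',
    forall w, w \in L -> [/\ admissible_node k.+1 m' w, (v.2 < w.2)%N,
      box k.+1 w `<=` box k v & excludes k.+1 v w] &
    forall (U : set 'rV[R]_2) rho, 0 < rho ->
      (forall x y, U x -> U y -> `|x - y| <= rho) ->
      (count (meets box U k.+1) L <= 1)%N \/
      (count (meets box U k.+1) L)%:R <=
        48 ^+ 2 * (rho / min_side psi k m) ^+ 2 * (nb_children psi C k m m')%:R].
Proof.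
case: v => [[p1 p2] q] [/= prim /andP[q0 qm] mq qsmall] m0.
move=> [[m'0 Hm'] Cm' small' mm' _].
have q0' : 0 < q%:R :> R by rewrite ltr0n.
have m'0' : 0 < m'%:R :> R by rewrite ltr0n.
have h0 := mesh_gt0 C_ge m'0.
set v : node := ((p1, p2), q).
have lside : min_side psi k m <= side k v by apply: min_side_le_side; rewrite q0.
have Hl := min_side_mesh C_ge m'0 Hm'.
have l0 := min_side_gt0 psi_gt0 k m0.
have e0 := @eta_gt0 R k; have e2 := @eta_le_half R k.
have e01 : 0 < eta k <= 1 by rewrite e0 (le_trans e2)// invf_le1// ler1n.
have Hm'2 : 224 * C%:R <= m'%:R * side k v.
  by apply: (le_trans Hm'); rewrite ler_pM2l.
have C1 : 1 <= C%:R :> R by rewrite ler1n -(ltr0n R).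
have half Q : (m' ^ 2 <= C * Q)%N -> Q%:R * psi Q <= 2^-1.
  move=> HQ; have Q0 : (0 < Q)%N.
    rewrite lt0n; apply/negP => /eqP Q00; move: HQ.
    by rewrite Q00 muln0 leqNgt expn_gt0 m'0.
  apply: le_trans (@eta_le_half R k.+1); apply: le_trans (small' Q HQ).
  rewrite ler_peMl// ?mulr_ge0 ?(ltW (psi_gt0 Q0))//.
  by rewrite mulr_ege1// exprn_ege1// ler1n.
have [A [cA HA]] := exists_children psi_gt0 psi_noninc q0 prim e01 C_ge qsmall
  Hm'2 (le_trans Hl lside) Cm' half.
rewrite -/(mesh m') -[psi q / q%:R]/(psi v.2 / v.2%:R) in A cA HA.
set M := Num.truncn _ in A cA HA.
have Mh : M%:R * mesh m' <= side k v.
  rewrite -ler_pdivlMr// truncn_le divr_ge0 ?(ltW h0)//.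
  exact: le_trans (ltW l0) lside.
pose Phi (g : 'I_M * 'I_M) (w : node) := [/\ primitive w.1.1 w.1.2 w.2,
   (0 < w.2 <= m' ^ 2)%N, (m' ^ 2 < C * w.2)%N,
   `|grid_pt (mesh m') (corner1 k v) g.1 - w.1.1%:~R / w.2%:R| <= mesh m' / 4 /\
   `|grid_pt (mesh m') (corner2 v) g.2 - w.1.2%:~R / w.2%:R| <= mesh m' / 4 &
   excludes k.+1 v w].
have [f Hf] : exists f : 'I_M * 'I_M -> node, forall g, A g -> Phi g (f g).
  suff H : forall g, exists w, A g -> Phi g w by have [f Hf] := choice H; exists f.
  move=> g; have [Ag|nAg] := pselect (A g); last by exists v.
  have [P1 [P2 [q' [h1 h2 h3 h4 h5]]]] := HA g Ag.
  exists ((P1, P2), q') => _; split => //= Q P x Qq nc bx.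
  have q'0 : (0 < q')%N by case/andP: h2.
  have [/ltW b1 /ltW b2] := @box_close k.+1 ((P1, P2), q') x q'0 bx.
  exact: h5 Qq nc b1 b2.
(* Surplus children are dropped so that every node of a level has the same number of them. *)
pose G := take (nb_children psi C k m m') (enum A).
have GA g : g \in G -> A g by move/mem_take; rewrite mem_enum.
have uG : uniq G by apply/take_uniq/enum_uniq.
(* 3/8 = 1/4 + 1/8: the distance from the grid point to the child rational, plus the radius
   psi(q')/q' of its approximation square. *)
have close g x : g \in G -> box k.+1 (f g) x ->
    `|grid_pt (mesh m') (corner1 k v) g.1 - x 0 0| <= 3 / 8 * mesh m' /\
    `|grid_pt (mesh m') (corner2 v) g.2 - x 0 1| <= 3 / 8 * mesh m'.
  move=> /GA/Hf[_ /andP[w0 _] wC [d1 d2] _] bx.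
  have [b1 b2] := box_close w0 bx.
  have w0' : 0 < (f g).2%:R :> R by rewrite ltr0n.
  have : psi (f g).2 / (f g).2%:R <= mesh m' / 8.
    have -> : psi (f g).2 / (f g).2%:R =
      ((f g).2%:R * psi (f g).2) / (f g).2%:R ^+ 2 by field; rewrite gt_eqF.
    rewrite ler_pdivrMr ?exprn_gt0//.
    apply: le_trans (half _ (ltnW wC)) _.
    have wC' : m'%:R ^+ 2 <= C%:R * (f g).2%:R :> R.
      by rewrite -natrX -natrM ler_nat ltnW.
    have -> : mesh m' / 8 * (f g).2%:R ^+ 2 =
      (C%:R * (f g).2%:R) ^+ 2 / (2 * C%:R * m'%:R ^+ 3).
      by rewrite /mesh; field; rewrite !gt_eqF.
    rewrite ler_pdivlMr ?mulr_gt0 ?exprn_gt0//.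
    apply: (@le_trans _ _ ((m'%:R ^+ 2) ^+ 2)); last first.
      by rewrite ler_sqr ?nnegrE ?exprn_ge0 ?mulr_ge0// ltW.
    have -> : 2^-1 * (2 * C%:R * m'%:R ^+ 3) = C%:R * m'%:R ^+ 3 :> R by field.
    have -> : (m'%:R ^+ 2) ^+ 2 = m'%:R * m'%:R ^+ 3 :> R by ring.
    by rewrite ler_pM2r ?exprn_gt0// ler_nat.
  move: d1 d2 b1 b2; rewrite !ler_norml !ltr_norml => /andP[? ?] /andP[? ?].
  move=> /andP[? ?] /andP[? ?] ?; split; apply/andP; split; lra.
exists [seq f g | g <- G]; split.
- rewrite size_map size_takel// -cardE -(ler_nat R).
  apply: le_trans cA; apply: le_trans (_ : (min_side psi k m / mesh m') ^+ 2 / 8 <= _).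
    by rewrite truncn_le divr_ge0 ?sqr_ge0.
  rewrite ler_pM2r ?invr_gt0//.
  have n1 : 0 <= min_side psi k m / mesh m' := divr_ge0 (ltW l0) (ltW h0).
  have n12 : min_side psi k m / mesh m' <= side k v / mesh m'.
    by rewrite ler_pM2r ?invr_gt0.
  by rewrite ler_sqr ?nnegrE// (le_trans n1).
- move=> _ /mapP[g gG ->]; have [w1 w2 w3 _ w5] := Hf g (GA g gG); split => //.
  + split=> //; first exact: ltnW.
    exact: small' (ltnW w3).
  + have Cpos : (0 < C)%N by rewrite -(ltr0n R).
    apply: leq_ltn_trans qm _; rewrite -(ltn_pmul2l Cpos).
    exact: leq_ltn_trans mm' w3.
  + move=> x bx; have [] := close g x gG bx.
    have Mg a (i : 'I_M) (y : R) :
        `|grid_pt (mesh m') a i - y| <= 3 / 8 * mesh m' -> a <= y <= a + side k v.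
      rewrite /grid_pt ler_norml => /andP[y1 y2].
      have i0 : 0 <= mesh m' * i%:R by rewrite mulr_ge0// ltW.
      have i1 : mesh m' * i.+1%:R <= side k v.
        by apply: le_trans Mh; rewrite mulrC ler_pM2r// ler_nat.
      rewrite -natr1 in i1.
      by apply/andP; split; lra.
    by move=> /Mg c1 /Mg c2; split.
move=> U rho rho0 HU; rewrite count_map.
rewrite -size_filter; set F := [seq g <- G | _].
have uF : uniq F by exact: filter_uniq.
have FP g : g \in F -> exists2 x, U x &
    `|grid_pt (mesh m') (corner1 k v) g.1 - x 0 0| <= 3 / 8 * mesh m' /\
    `|grid_pt (mesh m') (corner2 v) g.2 - x 0 1| <= 3 / 8 * mesh m'.
  rewrite mem_filter => /andP[/asboolP[x [bx Ux]] gG]; exists x => //.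
  exact: close gG bx.
case EF : F => [|g0 F']; first by left.
rewrite -EF; have [x0 Ux0 [d01 d02]] : exists2 x, U x &
    `|grid_pt (mesh m') (corner1 k v) g0.1 - x 0 0| <= 3 / 8 * mesh m' /\
    `|grid_pt (mesh m') (corner2 v) g0.2 - x 0 1| <= 3 / 8 * mesh m'.
  by apply: FP; rewrite EF mem_head.
pose t := rho / mesh m' + 3 / 4.
have t0 : 0 <= t by rewrite addr_ge0 ?divr_ge0// ltW.
have idx a (i j : 'I_M) (y z : R) :
    `|grid_pt (mesh m') a i - y| <= 3 / 8 * mesh m' ->
    `|grid_pt (mesh m') a j - z| <= 3 / 8 * mesh m' -> `|y - z| <= rho ->
    `|(i : nat)%:Z%:~R - j%:R| <= t.
  move=> hy hz yz.
  have -> : t = (rho + 3 / 4 * mesh m') / mesh m' by rewrite /t; field; rewrite gt_eqF.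
  rewrite ler_pdivlMr// -[X in _ * X](gtr0_norm h0) -normrM -pmulrn.
  move: hy hz yz; rewrite /grid_pt !ler_norml => /andP[? ?] /andP[? ?] /andP[? ?].
  by apply/andP; split; lra.
have idxF g : g \in F -> `|(g.1 : nat)%:Z%:~R - g0.1%:R| <= t /\
                         `|(g.2 : nat)%:Z%:~R - g0.2%:R| <= t.
  move=> /FP[x Ux [d1 d2]]; have xx0 := HU x x0 Ux Ux0.
  by split; [apply: idx d1 d01 _|apply: idx d2 d02 _];
    exact: le_trans (coord_le_norm _ _ _) xx0.
(* Below a quarter of the mesh, t < 1 forces equal grid indices. Above it, 2t + 1 <= 12 rho/h, and
   144 = 48^2/16 matches the lower bound for [nb_children]. *)
have [small|large] := ltP rho (mesh m' / 4).
  left; suff FE g : g \in F -> g = g0.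
    by apply: (@uniq_leq_size _ F [:: g0] uF) => g /FE ->; rewrite mem_head.
  have t1 : t < 1.
    have : rho / mesh m' < 4^-1 by rewrite ltr_pdivrMr// mulrC.
    rewrite /t; lra.
  have eqi (i j : 'I_M) : `|(i : nat)%:Z%:~R - j%:R : R| <= t -> i = j.
    move=> H; apply/val_inj/eqP; rewrite -eqz_nat -subr_eq0 -normr_le0 -ltz1D addr0.
    rewrite -(ltr_int R) intr_norm rmorphB /= -!pmulrn.
    by apply: le_lt_trans t1; rewrite -pmulrn in H.
  by case: g => g1 g2 /idxF[/= /eqi -> /eqi ->]; case: (g0).
right; apply: (@le_trans _ _ ((2 * t + 1) * (2 * t + 1))).
  apply: (@size_int_box R _ F (fun g => (g.1 : nat)%:Z) (fun g => (g.2 : nat)%:Z)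
    g0.1%:R g0.2%:R) => //.
  by move=> [i j] [i' j'] _ _ /= [/ord_inj -> /ord_inj ->].
have nc := nb_children_ge C_ge Hl m'0.
pose y := rho / mesh m'.
have y4 : 4^-1 <= y by rewrite ler_pdivlMr// mulrC.
apply: (@le_trans _ _ (144 * y ^+ 2)).
  have -> : 144 * y ^+ 2 = (12 * y) * (12 * y) by ring.
  have ty : 2 * t + 1 <= 12 * y by rewrite /t -/y; lra.
  by apply: ler_pM => //; lra.
have -> : 144 * y ^+ 2 = 48 ^+ 2 * (rho / min_side psi k m) ^+ 2 *
    ((min_side psi k m / mesh m') ^+ 2 / 16).
  by rewrite /y; field; rewrite !gt_eqF.
by rewrite ler_wpM2l// mulr_ge0 ?sqr_ge0.
Qed.

End Tree.

(** * Points on branches are exactly approximable *)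

Section Branches.
Context {R : realType}.
Variables (psi : nat -> R).
Hypothesis psi_gt0 : forall q, (0 < q)%N -> 0 < psi q.
Hypothesis psi_lt : forall q, (0 < q)%N -> psi q < 2^-1.
Hypothesis psi_noninc : forall p q : nat, (0 < p)%N -> (p <= q)%N ->
  q%:R * psi q <= p%:R * psi p.

Local Notation eta := (@eta R).
Local Notation node := ((int * int) * nat)%type.

Lemma eta_small (e : R) : 0 < e -> exists J, forall k, (J <= k)%N -> eta k <= e.
Proof.
move=> e0; exists (Num.truncn e^-1).+1 => k Jk.
rewrite /eta invf_ple ?posrE//; apply/ltW/(lt_le_trans (truncnS_gt _)).
by rewrite ler_nat (leq_trans Jk)// -addn2 leq_addr.
Qed.

Lemma side_ge0 k v : (0 < v.2)%N -> 0 <= side psi k v.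
Proof.
move=> v0; apply: divr_ge0 => //; apply: mulr_ge0; first exact/ltW/eta_gt0.
by rewrite divr_ge0// ltW// psi_gt0.
Qed.

Lemma side_le_eta k v : (0 < v.2)%N -> side psi k v <= eta k.
Proof.
move=> v0; have e0 := @eta_gt0 R k; have v0' : 1 <= v.2%:R :> R by rewrite ler1n.
have : psi v.2 / v.2%:R <= 1.
  rewrite ler_pdivrMr ?(lt_le_trans _ v0')// mul1r.
  by apply: le_trans v0'; have := psi_lt v0; lra.
rewrite /side => H; apply: (@le_trans _ _ (eta k * 1 / 2)); last by lra.
by rewrite ler_pM2r ?invr_gt0// ler_pM2l.
Qed.

Lemma box_corner k v : (0 < v.2)%N ->
  box psi k v (\row_(j < 2) if j == 0 then corner1 psi k v else corner2 v).
Proof.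
by move=> v0; rewrite /box /= !mxE /= !lexx !lerDl !side_ge0.
Qed.

(** In each coordinate the supremum of the lower ends lies in all intervals, since any two boxes of
    the chain share a point. *)
Lemma nested_boxes_meet (v : nat -> node) :
  (forall k, (0 < (v k).2)%N) ->
  (forall k, box psi k.+1 (v k.+1) `<=` box psi k (v k)) ->
  exists x, forall k, box psi k (v k) x.
Proof.
move=> v0 nest.
have nested j i : box psi (j + i) (v (j + i)%N) `<=` box psi j (v j).
  elim: i => [|i IH]; first by rewrite addn0.
  by rewrite addnS; apply: subset_trans IH; exact: nest.
have common j k : exists y, box psi j (v j) y /\ box psi k (v k) y.
  exists (\row_(i < 2) if i == 0 then corner1 psi (j + k) (v (j + k)%N)
    else corner2 (v (j + k)%N)).
  by split; [apply: (nested j k)|rewrite addnC; apply: (nested k j)];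
    exact: box_corner.
have sup_between (c d : nat -> R) : (forall j k, c j <= c k + d k) ->
    forall k, c k <= sup (range c) <= c k + d k.
  move=> cd k; have r0 : range c !=set0 by exists (c 0%N), 0%N.
  have ub : ubound (range c) (c k + d k) by move=> _ [j _ <-]; exact: cd.
  apply/andP; split; last exact: ge_sup.
  by apply: ub_le_sup; [exists (c k + d k)|exists k].
pose c1 k := corner1 psi k (v k); pose c2 k := corner2 (v k) : R.
pose d k := side psi k (v k).
have b1 : forall j k, c1 j <= c1 k + d k.
  move=> j k; have [y [[/andP[y1 _] _] [/andP[_ y2] _]]] := common j k.
  exact: le_trans y1 y2.
have b2 : forall j k, c2 j <= c2 k + d k.
  move=> j k; have [y [[_ /andP[y1 _]] [_ /andP[_ y2]]]] := common j k.
  exact: le_trans y1 y2.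
exists (\row_(i < 2) if i == 0 then sup (range c1) else sup (range c2)) => k.
by rewrite /box /= !mxE /=; split; [exact: sup_between b1 k|exact: sup_between b2 k].
Qed.

(** Every node of the branch approximates x within psi. Conversely a large Q lies in some [q_k,
    q_(k+1)). A rational P/Q different from p_k/q_k is excluded by the child. If they coincide, |Q
    x1 - P1| >= (Q/q_k)(1 - eta_k) psi(q_k) >= c psi(Q), because eta_k <= 1 - c. *)
Lemma branch_exact (v : nat -> node) (x : 'rV[R]_2) :
  (forall k, (0 < (v k).2)%N) -> (forall k, ((v k).2 < (v k.+1).2)%N) ->
  (forall k, excludes psi k.+1 (v k) (v k.+1)) ->
  (forall k, box psi k (v k) x) -> (forall i, 0 <= x 0 i <= 1) ->
  exact_approximable 2 psi x.
Proof.
move=> v0 vlt vex vx x01.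
have vge k : (k <= (v k).2)%N.
  by elim: k => // k IH; exact: leq_ltn_trans (vlt k).
have vmono j i : ((v j).2 <= (v (j + i)%N).2)%N.
  by elim: i => [|i IH]; rewrite ?addn0// addnS (leq_trans IH)// ltnW.
have scaled (Q : nat) (y z e : R) : (0 < Q)%N ->
    (`|y - z / Q%:R| < e / Q%:R) = (`|Q%:R * y - z| < e).
  move=> Q0; have Q0' : 0 < Q%:R :> R by rewrite ltr0n.
  rewrite ltr_pdivlMr// -[X in _ * X](gtr0_norm Q0') -normrM mulrBl.
  by rewrite divfK ?gt_eqF// mulrC.
split.
  split=> //; apply/infinite_setP => n; exists (v n).2 => //; split => //.
  apply/max_dist_intP; exists (v n).1.1, (v n).1.2.
  have [] := box_close psi_gt0 (v0 n) (vx n).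
  by rewrite !scaled.
move=> [c /= /andP[c0 c1] [_ /infinite_setP Hc]].
have c10 : 0 < 1 - c by rewrite subr_gt0.
have [K HK] := eta_small c10.
have [Q KQ [Q0 /max_dist_intP[P1 [P2 [h1 h2]]]]] := Hc (v K).2.
have Q0' : 0 < Q%:R :> R by rewrite ltr0n.
have [k [Kk kQ Qk]] : exists k, [/\ (K <= k)%N, ((v k).2 <= Q)%N & (Q < (v k.+1).2)%N].
  pose A i := ((v (K + i)%N).2 <= Q)%N.
  have A0 : exists i, A i by exists 0%N; rewrite /A addn0.
  have Abd i : A i -> (i <= Q)%N.
    by move=> Ai; apply: leq_trans Ai; apply: leq_trans (vge _); exact: leq_addl.
  have [i Ai imax] := ex_maxnP A0 Abd.
  exists (K + i)%N; split => //; first exact: leq_addr.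
  rewrite ltnNge -addnS; apply/negP => /imax; by rewrite ltnn.
have psiQ := psi_gt0 Q0.
have cpsi : c * psi Q < psi Q by rewrite -[ltRHS]mul1r ltr_pM2r.
have [col|ncol] := pselect (collinear (v k).1.1 (v k).1.2 (v k).2 (P1, P2) Q).
  have [/= e1 _] := col.
  have q0' : 0 < (v k).2%:R :> R by rewrite ltr0n.
  have eP : P1%:~R = Q%:R * ((v k).1.1%:~R / (v k).2%:R) :> R.
    have := congr1 (fun z : int => z%:~R : R) e1; rewrite !rmorphM /= -!pmulrn => e.
    by rewrite mulrA -e; field; rewrite gt_eqF.
  have [/andP[lo _] _] := vx k.
  move: h1; rewrite eP -mulrBr => /(le_lt_trans (ler_norm _)); apply/negP.
  rewrite -leNgt; set q := (v k).2 in q0' kQ eP lo *.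
  apply: (@le_trans _ _ (Q%:R * ((1 - eta k) * (psi q / q%:R)))); last first.
    by rewrite ler_pM2l//; move: lo; rewrite /corner1 -/q; lra.
  have ec : c <= 1 - eta k by have := HK k Kk; lra.
  have psiqQ : psi Q <= psi q.
    apply: le_trans (psi_le_inv psi_noninc (v0 k) kQ) _.
    by rewrite ler_pdivrMr// mulrC ler_wpM2l ?ler_nat// ltW// psi_gt0// v0.
  apply: (@le_trans _ _ ((1 - eta k) * psi q)).
    by apply: ler_pM => //; exact: ltW.
  have -> : Q%:R * ((1 - eta k) * (psi q / q%:R)) =
    (1 - eta k) * psi q * (Q%:R / q%:R) by field; rewrite gt_eqF.
  rewrite ler_peMr//; last by rewrite ler_pdivlMr// mul1r ler_nat.
  rewrite mulr_ge0 ?(ltW (psi_gt0 (v0 k)))//.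
  exact: le_trans (ltW c0) ec.
apply: (vex k Q (P1, P2) x _ ncol (vx k.+1)); first by rewrite kQ.
by rewrite !scaled//; split; [exact: lt_trans h1 cpsi|exact: lt_trans h2 cpsi].
Qed.

End Branches.

(** * The lower bound and the conclusion *)

Section LowerBound.
Context {R : realType}.
Variables (psi : nat -> R) (s theta : R).
Hypothesis psi_gt0 : forall q, (0 < q)%N -> 0 < psi q.
Hypothesis psi_lt : forall q, (0 < q)%N -> psi q < 2^-1.
Hypothesis psi_noninc : forall p q : nat, (0 < p)%N -> (p <= q)%N ->
  q%:R * psi q <= p%:R * psi p.
Hypothesis qpsi_small : forall e : R, 0 < e -> exists N, forall q, (N <= q)%N ->
  q%:R * psi q <= e.
Hypothesis psi_theta : exists N, forall q, (N <= q)%N ->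
  q%:R `^ (- theta) <= psi q.
Hypotheses (s_gt0 : 0 < s) (s_le2 : s <= 2) (s_theta : s * (theta + 1) < 3).

Local Notation node := ((int * int) * nat)%type.

Lemma exact_approximable_content : exists2 c : R, 0 < c &
  (c%:E <= hausdorff_content s 1 (exact_approximable 2 psi))%E.
Proof.
have [C C_ge] : exists C : nat, 48 ^+ 2 <= C%:R :> R.
  by exists (Num.truncn (48 ^+ 2 : R)).+1; exact/ltW/truncnS_gt.
have C0 : 0 < C%:R :> R by apply: lt_le_trans C_ge; rewrite exprn_gt0.
have e0 : 0 < @eta R 0 / (55 ^+ 2 * C%:R).
  by rewrite divr_gt0 ?eta_gt0// mulr_gt0// exprn_gt0.
have [N HN] := qpsi_small e0.
pose nxt k m := xget 0%N [set m' | next_scale psi C s k m m'].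
pose fix sc k := if k is k'.+1 then nxt k' (sc k') else N.+2.
have nxtP k m : (0 < m)%N -> next_scale psi C s k m (nxt k m).
  move=> m0; have [m' Hm'] :=
    next_scale_exists psi_gt0 qpsi_small psi_theta C_ge s_gt0 s_theta k m0.
  exact: (@xgetPex _ 0%N [set m' | next_scale psi C s k m m'] (ex_intro _ m' Hm')).
have sc0 k : (0 < sc k)%N.
  by elim: k => // k IH /=; have [[]] := nxtP k _ IH.
have scP k : next_scale psi C s k (sc k) (sc k.+1) by exact: nxtP.
pose n k := nb_children psi C k (sc k) (sc k.+1).
pose l k := min_side psi k (sc k).
pose ok k (v : node) := admissible_node psi C k (sc k) v.
pose good k v (L : seq node) := [/\ size L = n k,
    forall w, w \in L -> [/\ ok k.+1 w, (v.2 < w.2)%N,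
      box psi k.+1 w `<=` box psi k v & excludes psi k.+1 v w] &
    forall (U : set 'rV[R]_2) rho, 0 < rho ->
      (forall x y, U x -> U y -> `|x - y| <= rho) ->
      (count (meets (box psi) U k.+1) L <= 1)%N \/
      (count (meets (box psi) U k.+1) L)%:R <=
        48 ^+ 2 * (rho / l k) ^+ 2 * (n k)%:R].
pose ch k v := xget [::] [set L | good k v L].
have chP k v : ok k v -> good k v (ch k v).
  move=> okv; have [L HL] :=
    children_list psi_gt0 psi_noninc C_ge okv (sc0 k) (scP k).
  exact: (@xgetPex _ [::] [set L | good k v L] (ex_intro _ L HL)).
(* The point (1/q0, 1/q0) is in lowest terms whatever q0 is; q0 >= N makes q0 psi(q0) small enough,
   and q0 >= 2 keeps its approximation square inside the unit square. *)
pose q0 := (N.+2 ^ 2)%N; pose root : node := ((1, 1), q0).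
have q0_ge : (N + 2 <= q0)%N by rewrite /q0 -mulnn; nia.
have Cpos : (0 < C)%N by rewrite -(ltr0n R).
have ok_root : ok 0%N root.
  split => //=.
  - move=> t T1 T2 /andP[t0 tq] e _; move: e; rewrite mulr1 => e.
    have : (q0 %| t)%N by apply/dvdnP; exists `|T1|%N; lia.
    by move=> /(dvdn_leq t0); rewrite leqNgt tq.
  - by rewrite leq_pmull.
  - rewrite mulrC -ler_pdivlMr; last by rewrite mulr_gt0// exprn_gt0.
    by apply: HN; apply: leq_trans q0_ge; exact: leq_addr.
have okv0 k v : ok k v -> (0 < v.2)%N by case=> _ /andP[].
have l_eta k : l k <= @eta R k.
  have := @side_le_eta R psi psi_lt k ((0, 0), (sc k ^ 2)%N).
  by rewrite /l /side /min_side; apply; rewrite /= expn_gt0 sc0.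
have content := @cantor_content R 'rV[R]_2 node (box psi) ch ok root n l
  (48 ^+ 2) s ok_root.
have okP v : branch ch root v -> forall k, ok k (v k).
  move=> [v0 vS]; elim=> [|k IH]; first by rewrite v0.
  by have [_ /(_ _ (vS k))[]] := chP k _ IH.
apply: content => //.
- by move=> k v w /chP[_ + _] => /[apply] -[].
- by move=> k v /chP[].
- by move=> k v w /chP[_ + _] => /[apply] -[].
- by move=> k v /okv0 v0; eexists; exact: box_corner.
- move=> e /eta_small[J HJ]; exists J => k v Jk okv x y.
  move=> [/andP[x1 x2] /andP[x3 x4]] [/andP[y1 y2] /andP[y3 y4]].
  have := HJ k Jk; have := side_le_eta psi_lt k (okv0 _ _ okv).
  have := @eta_gt0 R k => ? ? ?.
  apply: norm_le_coord; rewrite ?ler_norml; try (apply/andP; split); lra.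
- by move=> k; exact: min_side_gt0.
- move=> e /eta_small[J HJ]; exists J => k Jk.
  exact: le_trans (l_eta k) (HJ k Jk).
- by apply: le_trans (l_eta 0%N) _; rewrite invf_le1// ler1n.
- by rewrite exprn_ege1// ler1n.
- move=> v vB; apply: nested_boxes_meet => // k.
    exact: okv0 (okP _ vB k).
  by have [_ /(_ _ (vB.2 k))[]] := chP k _ (okP _ vB k).
- by move=> k v U rho /chP[_ _]; exact.
- by move=> k; have [_ _ _ _] := scP k.
move=> x [v [vB vx]].
have step k : [/\ ok k.+1 (v k.+1), ((v k).2 < (v k.+1).2)%N,
    box psi k.+1 (v k.+1) `<=` box psi k (v k) & excludes psi k.+1 (v k) (v k.+1)].
  by have [_ /(_ _ (vB.2 k))] := chP k _ (okP _ vB k).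
apply: (branch_exact psi_gt0 psi_noninc (v := v)) => //.
- by move=> k; exact: okv0 (okP _ vB k).
- by move=> k; have [] := step k.
- by move=> k; have [] := step k.
have := vx 0%N; rewrite vB.1 => bx.
have [] := box_close psi_gt0 (okv0 _ _ ok_root) bx.
have q2 : 2 <= q0%:R :> R by rewrite ler_nat (leq_trans _ q0_ge)// leq_addl.
have q0' : 0 < q0%:R :> R by lra.
have small : psi q0 / q0%:R <= q0%:R^-1.
  rewrite ler_pdivrMr// mulVf ?gt_eqF//.
  have := @psi_lt q0; rewrite -(ltr0n R) => /(_ q0'); lra.
have big : q0%:R^-1 <= 2^-1 :> R by rewrite lef_pV2 ?posrE.
rewrite /= !mul1r !ltr_norml => /andP[? ?] /andP[? ?].
by apply: ord2_ind; apply/andP; split; lra.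
Qed.

End LowerBound.

Lemma hausdorff_measure_sub0 (R : realType) (V : normedModType R) (s : R)
    (A B : set V) :
  A `<=` B -> hausdorff_measure s B = 0%E -> hausdorff_measure s A = 0%E.
Proof.
move=> AB B0; have content_ge0 d (D : set V) : (0 <= hausdorff_content s d D)%E.
  apply: le_ereal_inf_tmp => _ [U _ <-].
  by apply: nneseries_ge0 => i _ _; exact: diam_pow_ge0.
apply/eqP; rewrite eq_le; apply/andP; split; last first.
  by apply: le_trans (content_ge0 1 A) _; apply: ereal_sup_ubound; exists 1 => //=.
rewrite -B0; apply: ge_ereal_sup => _ [d d0 <-].
apply: le_trans (_ : hausdorff_content s d B <= _)%E; last first.
  by apply: ereal_sup_ubound; exists d.
apply: ereal_inf_le_tmp => _ [U [BU dU] <-]; exists U => //; split => //.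
exact: subset_trans BU.
Qed.

Theorem theorem1p1 (R : realType) (psi : nat -> R) (lambda : \bar R)
  (psi_range : forall q : nat, (0 < q)%N -> 0 <= psi q < 2^-1)
  (qpsi_noninc : forall p q : nat, (0 < p)%N -> (p <= q)%N ->
     q%:R * psi q <= p%:R * psi p)
  (qpsi_to0 : (fun q : nat => q%:R * psi q) @ \oo --> (0 : R))
  (psi_order :
     (fun q : nat => (- lne (psi q)%:E / (ln q%:R)%:E)%E) @ \oo --> lambda) :
  hausdorff_dim (exact_approximable 2 psi) = (3%:E / (lambda + 1))%E.
Proof.
have dim_ge0 : (0 <= hausdorff_dim (exact_approximable 2 psi))%E.
  by apply: le_ereal_inf_tmp => _ [s [s0 _] <-]; rewrite lee_fin.
have upper s tau : 0 < s -> (tau%:E < lambda)%E -> -1 < tau ->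
    3 < s * (tau + 1) -> (hausdorff_dim (exact_approximable 2 psi) <= s%:E)%E.
  move=> s0 tl tau1 st; have [N HN] := psi_le_powR psi_order tl.
  apply: ge_ereal_inf; exists s%:E => //; exists s => //; split; first exact: ltW.
  apply: hausdorff_measure_sub0 (hausdorff_measure_well_approximable
    psi_range HN s0 st tau1); exact: subDsetl.
have := order_ge1 psi_range qpsi_to0 psi_order.
case: lambda psi_order upper => [l| |] psi_order upper l1 //; last first.
  have -> : (3%:E / (+oo + 1) = 0 :> \bar R)%E by rewrite addye// invey mule0.
  apply/eqP; rewrite eq_le dim_ge0 andbT; apply/lee_addgt0Pr => e e0.
  (* For infinite order any real tau is admissible; this one gives e (tau + 1) = 3 + e. *)
  rewrite add0e; apply: (upper e (3 / e)) => //; first exact: ltry.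
    by apply: lt_le_trans (_ : 0 <= _); rewrite ?divr_ge0 ?(ltW e0)//; lra.
  by rewrite mulrDr mulr1 mulrC divfK ?gt_eqF// ltrDl.
rewrite lee_fin in l1; have l10 : 0 < l + 1 by lra.
have -> : (3%:E / (l%:E + 1) = (3 / (l + 1))%:E :> \bar R)%E.
  by rewrite -EFinD inver gt_eqF.
set v := 3 / (l + 1); have v0 : 0 < v by rewrite divr_gt0.
have vl : v * (l + 1) = 3 by rewrite divfK ?gt_eqF.
apply/eqP; rewrite eq_le; apply/andP; split.
  apply/lee_addgt0Pr => e e0; rewrite -EFinD.
  have s0 : 0 < v + e by rewrite addr_gt0.
  (* Midpoint between l and the critical value of tau for the exponent v + e. *)
  pose tau := (3 / (v + e) - 1 + l) / 2.
  have lt3 : 3 / (v + e) < l + 1.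
    by rewrite ltr_pdivrMr// mulrDr mulrC vl ltrDl mulr_gt0.
  have pos3 : 0 < 3 / (v + e) by rewrite divr_gt0.
  apply: (upper _ tau) => //; rewrite ?lte_fin /tau; [lra|lra|].
  have e3 : 3 = (v + e) * (3 / (v + e)) by rewrite mulrC divfK ?gt_eqF.
  by rewrite [ltLHS]e3 ltr_pM2l//; lra.
apply: le_ereal_inf_tmp => _ [s [s0 m0] <-]; rewrite lee_fin leNgt.
(* An exponent strictly between s and v is positive even if s = 0, and being below v it leaves room
   for some theta > l with s' (theta + 1) < 3. *)
apply/negP => sv; pose s' := (s + v) / 2.
have s'0 : 0 < s' by rewrite /s'; lra.
have s'v : s' < v by rewrite /s'; lra.
have s'2 : s' <= 2.
  apply: le_trans (ltW s'v) _; rewrite ler_pdivrMr//; lra.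
have gt3 : l + 1 < 3 / s'.
  by rewrite ltr_pdivlMr// -vl [ltRHS]mulrC ltr_pM2l.
pose theta := (3 / s' - 1 + l) / 2.
have ltheta : (l%:E < theta%:E)%E by rewrite lte_fin /theta; lra.
have s'theta : s' * (theta + 1) < 3.
  have e3 : 3 = s' * (3 / s') by rewrite mulrC divfK ?gt_eqF.
  by rewrite [ltRHS]e3 ltr_pM2l// /theta; lra.
have psi_pos := psi_gt0 psi_range qpsi_noninc qpsi_to0 psi_order (ltry l).
have psi_lt q : (0 < q)%N -> psi q < 2^-1 by move=> /psi_range/andP[].
have [c c0 Hc] := exact_approximable_content psi_pos psi_lt qpsi_noninc
  (qpsi_small qpsi_to0) (psi_ge_powR psi_range psi_order ltheta) s'0 s'2 s'theta.
apply: (hausdorff_measure_neq0 _ c0 Hc) m0.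
by rewrite s0 /s' /=; lra.
Qed.
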